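(* Let $a\in\mathbb{C}$ with $a\notin\{-1,-2,-3,\dots\}$. Then for all $x\in\mathbb{C}$ sufficiently close to $0$, $$(1-x)^{-2a}\,{}_2F_1\left(\tfrac a3,\tfrac{2a}{3};\tfrac a3+1;\left(\frac{x}{x-1}\right)^3\right)=F_1\left(a;\tfrac12,\tfrac23a;a+1;4x(1-x),3x(1-x)\right).$$
   Context: $(q)_n=q(q+1)\cdots(q+n-1)$, $(q)_0=1$. ${}_2F_1(a,b;c;z)=\sum_{k\ge0}\frac{(a)_k(b)_k}{(c)_k}\frac{z^k}{k!}$ for $|z|<1$. Appell's function $F_1$ is, for $|X|,|Y|<1$ and $c\notin\{0,-1,-2,\dots\}$, $F_1(a;b_1,b_2;c;X,Y):=\sum_{j,k\ge0}\frac{(a)_{j+k}}{(c)_{j+k}}\frac{(b_1)_j(b_2)_k}{j!\,k!}X^jY^k$. The power $(1-x)^{-2a}$ is the branch with value $1$ at $x=0$. *)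

(* Defs.v *)
(* Stdlib real numbers with Coquelicot's complex numbers [C]. *)
From Stdlib Require Import Arith Reals Lra.
From Coquelicot Require Import Coquelicot.
Open Scope C_scope.

(* [Cpow] is the power with a natural number exponent; the power with a complex
   exponent is [Cpower], built on the principal logarithm. *)

Definition Cexp (z : C) : C :=
  ((exp (Re z) * cos (Im z))%R, (exp (Re z) * sin (Im z))%R).

Definition Carg (z : C) : R :=
  if Rle_dec 0 (Im z) then acos (Re z / Cmod z) else (- acos (Re z / Cmod z))%R.

Definition Clog (z : C) : C := (ln (Cmod z), Carg z).

(* The principal branch: holomorphic in [z] off the half-line (-oo, 0], with
   value 1 at [z = 1]. *)
Definition Cpower (z w : C) : C := Cexp (w * Clog z).

Fixpoint poch (q : C) (n : nat) : C :=
  match n with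
  | O => 1
  | S m => poch q m * (q + INR m)
  end.

Definition nonpos_integer (c : C) : Prop := exists n : nat, c = - INR n.

Definition is_hyp2F1 (a b c z s : C) : Prop :=
  ~ nonpos_integer c /\ (Cmod z < 1)%R /\
  is_series (V := C_NormedModule)
    (fun k => poch a k * poch b k / poch c k * (z ^ k / INR (fact k))) s.

(* Convergence of the rectangular partial sums, the two bounds tending to
   infinity independently. *)
Definition is_double_series (u : nat -> nat -> C) (s : C) : Prop :=
  filterlim
    (fun p : nat * nat =>
       sum_n (G := C_NormedModule)
         (fun j => sum_n (G := C_NormedModule) (u j) (snd p)) (fst p))
    (filter_prod eventually eventually) (locally (T := C_NormedModule) s).

Definition is_appellF1 (a b1 b2 c X Y s : C) : Prop :=
  ~ nonpos_integer c /\ (Cmod X < 1)%R /\ (Cmod Y < 1)%R /\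
  is_double_series
    (fun j k =>
       poch a (j + k) / poch c (j + k)
       * (poch b1 j * poch b2 k / (INR (fact j) * INR (fact k)))
       * X ^ j * Y ^ k) s.

Lemma Re_div_Cmod_bound (z : C) : z <> 0 -> (-1 <= Re z / Cmod z <= 1)%R.
Proof.
intros Hz.
assert (Hp : (0 < Cmod z)%R) by now apply Cmod_gt_0.
pose proof (re_le_Cmod z) as H; apply Rabs_le_between in H.
split; apply (Rmult_le_reg_r (Cmod z)); trivial;
  replace (Re z / Cmod z * Cmod z)%R with (Re z) by (field; lra); lra.
Qed.

Lemma Carg_bound (z : C) : z <> 0 -> (- PI < Carg z <= PI)%R.
Proof.
intros Hz; unfold Carg.
assert (Hp : (0 < Cmod z)%R) by now apply Cmod_gt_0.
pose proof PI_RGT_0.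
pose proof (acos_bound (Re z / Cmod z)).
destruct (Rle_dec 0 (Im z)) as [h|h]; [lra|].
assert (acos (Re z / Cmod z) <> PI); [|lra].
intros E.
pose proof (cos_acos _ (Re_div_Cmod_bound z Hz)) as Hc.
rewrite E, cos_PI in Hc.
assert (Hre : Re z = (- Cmod z)%R).
{ replace (Re z) with (Re z / Cmod z * Cmod z)%R by (field; lra).
  rewrite <- Hc; ring. }
pose proof (Cmod2_alt z) as H2; rewrite Hre in H2; nra.
Qed.

Lemma Cexp_Clog (z : C) : z <> 0 -> Cexp (Clog z) = z.
Proof.
intros Hz.
assert (Hp : (0 < Cmod z)%R) by now apply Cmod_gt_0.
pose proof (Re_div_Cmod_bound z Hz) as Hb.
pose proof (Cmod2_alt z) as H2.
assert (Hs : (Cmod z * sqrt (1 - (Re z / Cmod z)²) = Rabs (Im z))%R).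
{ rewrite <- (sqrt_Rsqr (Cmod z)) at 1 by lra.
  rewrite <- sqrt_mult_alt by apply Rle_0_sqr.
  rewrite <- sqrt_Rsqr_abs; f_equal; unfold Rsqr.
  transitivity (Cmod z ^ 2 - Re z ^ 2)%R; [field; lra|rewrite H2; ring]. }
unfold Cexp, Clog, Carg; simpl; rewrite exp_ln by trivial.
destruct z as [x y]; simpl in *.
destruct (Rle_dec 0 y) as [h|h];
  rewrite ?cos_neg, ?sin_neg, cos_acos, sin_acos by trivial; f_equal;
  try (field; lra).
- now rewrite Hs, Rabs_pos_eq.
- rewrite Ropp_mult_distr_r_reverse, Hs, Rabs_left; lra.
Qed.

Lemma Cpower_1_l (w : C) : Cpower 1 w = 1.
Proof.
unfold Cpower, Clog, Carg; simpl; rewrite Cmod_1, ln_1.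
destruct (Rle_dec 0 0) as [_|h]; [|now destruct h; apply Rle_refl].
replace (1 / 1)%R with 1%R by field; rewrite acos_1.
replace (w * (0%R, 0%R)) with (RtoC 0) by (unfold RtoC, Cmult; simpl; f_equal; ring).
unfold Cexp; simpl; rewrite exp_0, cos_0, sin_0; unfold RtoC; f_equal; ring.
Qed.

(* Main.v *)
Require Import Defs.
From Stdlib Require Import Arith Reals Lra Lia.
From Coquelicot Require Import Coquelicot.
Open Scope C_scope.

(** Write [p = x (1 - x)], [w = (x / (x - 1))^3] and [b = 2 a / 3].  Since
    [(a)_n / (a+1)_n = a / (a + n)], the Appell series on the line
    [(X, Y) = (4 y, 3 y)] is a function [H y] of one variable, and the Gauss
    series is a function [K w], with

      - [y H'(y) + a H(y) = a (1 - 4 y)^(-1/2) (1 - 3 y)^(-b)],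
      - [3 w K'(w) + a K(w) = a (1 - w)^(-b)].

    Behind the theorem is the substitution [v = s / (1 - s)] in the Euler
    integrals of both sides.  Indeed [1 - 4 p = (1 - 2 x)^2] cancels the
    Jacobian of [x -> p], and [1 - 3 p = (1 - x)^3 + x^3 = (1 - x)^3 (1 - w)]
    matches the two remaining factors ([Binom_half], [Binom_quadratic]).  The
    integrals diverge for [Re a <= 0], so the proof argues with the
    differential equations instead: by the two relations, the function

      [D x = (1 - x)^a H(p) - (1 - x)^(-a) K(w)]

    satisfies [x D' + a D = 0] ([defect_ode]) and [D 0 = 0].  The solutions of
    this equation are the multiples of [x^(-a)], which is singular at 0 unless
    [- a] is a natural number, that is [a = 0] here; so [D], smooth and zero at 0, is 0.
    The proof of this ([euler_ode_zero]) avoids the power: differentiating [n]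
    times replaces [a] by [a + n], and once [Re (a + n) >= 0] the modulus of a
    solution does not increase along a ray from 0.  Multiplying [D = 0] by
    [(1 - x)^(-a)] gives the theorem.

    The powers of [1 - y] are handled as binomial series [Binom b y], the sum
    of [(b)_n / n! y^n].  Identities between them hold because the logarithmic
    derivative of a suitable product vanishes, and the comparison with the
    principal branch ([Cpower_Binom]) is made along the segment from 0 to [x].
    Finally the rectangular partial sums of the Appell series converge to the
    sum of its diagonals ([is_double_series_diagonal]), which is [H]. *)

(** * Complex derivatives *)

(** [C] is taken as the normed module of its own absolute ring, the form in which
    the product and chain rules are stated. *)
Definition cderive (f : C -> C) (z d : C) : Prop :=
  is_derive (K := C_AbsRing) (V := AbsRing_NormedModule C_AbsRing) f z d.

Lemma cderive_eps (f : C -> C) (z d : C) :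
  cderive f z d <->
  forall eps : R, (0 < eps)%R -> exists del : R, (0 < del)%R /\
    forall h : C, (Cmod h < del)%R ->
      (Cmod (f (z + h)%C - f z - d * h) <= eps * Cmod h)%R.
Proof.
split.
- intros [_ H] eps Heps.
  specialize (H z (fun P HP => HP) (mkposreal eps Heps)).
  destruct H as [del Hd].
  exists del; split; [apply cond_pos|].
  intros h Hh.
  specialize (Hd (z + h)).
  assert (Hb : ball (M := AbsRing_UniformSpace C_AbsRing) z del (z + h)).
  { change (Cmod ((z + h) - z) < del)%R. now replace (z + h - z) with h by ring. }
  specialize (Hd Hb).
  change (Cmod (f (z + h)%C - f z - ((z + h) - z) * d) <= eps * Cmod ((z + h) - z))%R in Hd.
  replace (z + h - z) with h in Hd by ring.
  now rewrite (Cmult_comm d h).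
- intros H; split.
  + apply (is_linear_scal_l (K := C_AbsRing) (V := AbsRing_NormedModule C_AbsRing)).
  + intros x Hx.
    apply (is_filter_lim_locally_unique (V := AbsRing_NormedModule C_AbsRing)) in Hx.
    subst x.
    intros eps.
    destruct (H eps (cond_pos eps)) as [del [Hdel Hd]].
    exists (mkposreal del Hdel).
    intros y Hy.
    change (Cmod (y - z) < del)%R in Hy.
    specialize (Hd _ Hy).
    assert (Ey : forall u v : C, u + (v - u) = v) by (intros; ring).
    rewrite Ey in Hd.
    rewrite (Cmult_comm d) in Hd.
    exact Hd.
Qed.

Lemma cderive_unique (f : C -> C) (z d1 d2 : C) :
  cderive f z d1 -> cderive f z d2 -> d1 = d2.
Proof.
rewrite !cderive_eps; intros H1 H2.
apply Ceq_minus, Cmod_eq_0, Rle_antisym; [|apply Cmod_ge_0].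
apply le_epsilon; intros e He.
destruct (H1 (e / 2)%R ltac:(lra)) as [r1 [Hr1 K1]].
destruct (H2 (e / 2)%R ltac:(lra)) as [r2 [Hr2 K2]].
set (t := (Rmin r1 r2 / 2)%R).
assert (Ht : (0 < t)%R) by (unfold t; pose proof (Rmin_glb_lt _ _ _ Hr1 Hr2); lra).
assert (Hm : Cmod t = t) by (rewrite Cmod_R; apply Rabs_pos_eq; lra).
specialize (K1 (RtoC t)); specialize (K2 (RtoC t)); rewrite Hm in K1, K2.
assert (t < r1)%R by (unfold t in *; pose proof (Rmin_l r1 r2); lra).
assert (t < r2)%R by (unfold t in *; pose proof (Rmin_r r1 r2); lra).
specialize (K1 ltac:(assumption)); specialize (K2 ltac:(assumption)).
apply (Rmult_le_reg_r t); trivial.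
rewrite <- Hm at 1; rewrite <- Cmod_mult.
replace ((d1 - d2) * t) with
  ((f (z + t)%C - f z - d2 * t) + - (f (z + t)%C - f z - d1 * t)) by ring.
eapply Rle_trans; [apply Cmod_triangle|rewrite Cmod_opp; lra].
Qed.

Lemma cderive_eq (f : C -> C) (z d d' : C) : cderive f z d -> d = d' -> cderive f z d'.
Proof. now intros H <-. Qed.

Lemma cderive_const (c z : C) : cderive (fun _ => c) z 0.
Proof. exact (is_derive_const (K := C_AbsRing) (V := AbsRing_NormedModule C_AbsRing) c z). Qed.

Lemma cderive_id (z : C) : cderive (fun x => x) z 1.
Proof. exact (is_derive_id (K := C_AbsRing) z). Qed.

Lemma cderive_plus (f g : C -> C) (z df dg : C) :
  cderive f z df -> cderive g z dg -> cderive (fun x => f x + g x) z (df + dg).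
Proof. exact (is_derive_plus (K := C_AbsRing) (V := AbsRing_NormedModule C_AbsRing) f g z df dg). Qed.

Lemma cderive_mult (f g : C -> C) (z df dg : C) :
  cderive f z df -> cderive g z dg ->
  cderive (fun x => f x * g x) z (df * g z + f z * dg).
Proof.
intros Hf Hg.
exact (is_derive_mult (K := C_AbsRing) f g z df dg Hf Hg Cmult_comm).
Qed.

Lemma cderive_comp (f g : C -> C) (z df dg : C) :
  cderive f (g z) df -> cderive g z dg -> cderive (fun x => f (g x)) z (dg * df).
Proof. exact (is_derive_comp (K := C_AbsRing) (V := AbsRing_NormedModule C_AbsRing) f g z df dg). Qed.

Lemma cderive_ext_disc (f g : C -> C) (r : R) (z d : C) :
  (forall x, (Cmod x < r)%R -> f x = g x) -> (Cmod z < r)%R ->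
  cderive f z d -> cderive g z d.
Proof.
intros E Hz; rewrite !cderive_eps; intros H eps Heps.
destruct (H eps Heps) as [del [Hdel K]].
exists (Rmin del (r - Cmod z)); split.
- apply Rmin_glb_lt; lra.
- intros h Hh.
  pose proof (Rmin_l del (r - Cmod z)); pose proof (Rmin_r del (r - Cmod z)).
  rewrite <- !E; trivial.
  + apply K; lra.
  + eapply Rle_lt_trans; [apply Cmod_triangle|lra].
Qed.

Lemma is_derive_Rmult (f g : R -> R) (t df dg : R) :
  is_derive f t df -> is_derive g t dg ->
  is_derive (fun s => f s * g s)%R t (df * g t + f t * dg)%R.
Proof. intros Hf Hg; exact (is_derive_mult (K := R_AbsRing) f g t df dg Hf Hg Rmult_comm). Qed.

Lemma is_derive_Rplus (f g : R -> R) (t df dg : R) :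
  is_derive f t df -> is_derive g t dg ->
  is_derive (fun s => f s + g s)%R t (df + dg)%R.
Proof. exact (is_derive_plus (K := R_AbsRing) (V := R_NormedModule) f g t df dg). Qed.

Lemma is_derive_Rminus (f g : R -> R) (t df dg : R) :
  is_derive f t df -> is_derive g t dg ->
  is_derive (fun s => f s - g s)%R t (df - dg)%R.
Proof. exact (is_derive_minus (K := R_AbsRing) (V := R_NormedModule) f g t df dg). Qed.

(** * Complex-valued functions of a real parameter *)

Definition pderive (phi : R -> C) (t : R) (d : C) : Prop :=
  is_derive (fun s => Re (phi s)) t (Re d) /\ is_derive (fun s => Im (phi s)) t (Im d).

Lemma pderive_eq (phi : R -> C) t (d d' : C) : pderive phi t d -> d = d' -> pderive phi t d'.
Proof. now intros H <-. Qed.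

Lemma pderive_mult (phi psi : R -> C) (t : R) (d e : C) :
  pderive phi t d -> pderive psi t e ->
  pderive (fun s => phi s * psi s) t (d * psi t + phi t * e).
Proof.
intros [H1 H2] [H3 H4]; split.
- apply (is_derive_ext (fun s => Re (phi s) * Re (psi s) - Im (phi s) * Im (psi s))%R).
  { intros s; now rewrite re_mult. }
  replace (Re (d * psi t + phi t * e)) with
    ((Re d * Re (psi t) + Re (phi t) * Re e) - (Im d * Im (psi t) + Im (phi t) * Im e))%R
    by (unfold Re, Im; simpl; ring).
  apply is_derive_Rminus; now apply is_derive_Rmult.
- apply (is_derive_ext (fun s => Re (phi s) * Im (psi s) + Im (phi s) * Re (psi s))%R).
  { intros s; now rewrite im_mult. }
  replace (Im (d * psi t + phi t * e)) with
    ((Re d * Im (psi t) + Re (phi t) * Im e) + (Im d * Re (psi t) + Im (phi t) * Re e))%R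
    by (unfold Re, Im; simpl; ring).
  apply is_derive_Rplus; now apply is_derive_Rmult.
Qed.

Lemma is_derive_eps (f : R -> R) (t d : R) :
  (forall eps : R, (0 < eps)%R -> exists del : R, (0 < del)%R /\
    forall h : R, (Rabs h < del)%R -> (Rabs (f (t + h) - f t - d * h) <= eps * Rabs h)%R) ->
  is_derive f t d.
Proof.
intros H; split; [apply (is_linear_scal_l (K := R_AbsRing))|].
intros x Hx.
apply (is_filter_lim_locally_unique (V := R_NormedModule)) in Hx; subst x.
intros eps.
destruct (H eps (cond_pos eps)) as [del [Hdel Hd]].
exists (mkposreal del Hdel).
intros y Hy.
change (Rabs (y - t) < del)%R in Hy.
specialize (Hd _ Hy).
assert (Ey : forall u v : R, (u + (v - u) = v)%R) by (intros; ring).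
rewrite Ey in Hd.
rewrite (Rmult_comm d) in Hd.
exact Hd.
Qed.

Lemma pderive_ray (f : C -> C) (x : C) (t : R) (d : C) :
  cderive f (t * x)%C d -> pderive (fun s => f (s * x)) t (d * x).
Proof.
rewrite cderive_eps; intros H.
assert (K : forall eps : R, (0 < eps)%R -> exists del : R, (0 < del)%R /\
    forall h : R, (Rabs h < del)%R ->
    (Cmod (f ((t + h)%R * x)%C - f (t * x)%C - d * x * h) <= eps * Rabs h)%R).
{ intros eps Heps.
  pose proof (Cmod_ge_0 x).
  destruct (H (eps / (Cmod x + 1))%R ltac:(apply Rdiv_lt_0_compat; lra)) as [del [Hdel Hd]].
  exists (del / (Cmod x + 1))%R; split; [apply Rdiv_lt_0_compat; lra|].
  intros h Hh.
  pose proof (Rabs_pos h).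
  apply (Rmult_lt_compat_r (Cmod x + 1)) in Hh; [|lra].
  replace (del / (Cmod x + 1) * (Cmod x + 1))%R with del in Hh by (field; lra).
  specialize (Hd (h * x)); rewrite Cmod_mult, Cmod_R in Hd.
  specialize (Hd ltac:(nra)).
  replace (t * x + h * x) with ((t + h)%R * x) in Hd by (rewrite RtoC_plus; ring).
  replace (d * x * h) with (d * (h * x)) by ring.
  eapply Rle_trans; [exact Hd|].
  replace (eps * Rabs h)%R with (eps / (Cmod x + 1) * (Rabs h * (Cmod x + 1)))%R
    by (field; lra).
  apply Rmult_le_compat_l; [|nra].
  apply Rlt_le, Rdiv_lt_0_compat; lra. }
split; apply is_derive_eps; intros eps Heps;
  destruct (K eps Heps) as [del [Hdel Hd]]; exists del; split; trivial;
  intros h Hh; (eapply Rle_trans; [|apply (Hd h Hh)]).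
- replace (Re (f ((t + h)%R * x)%C) - Re (f (t * x)%C) - Re (d * x) * h)%R with
   (Re (f ((t + h)%R * x)%C - f (t * x)%C - d * x * h)) by (unfold Re, Im; simpl; ring).
  apply re_le_Cmod.
- replace (Im (f ((t + h)%R * x)%C) - Im (f (t * x)%C) - Im (d * x) * h)%R with
   (Im (f ((t + h)%R * x)%C - f (t * x)%C - d * x * h)) by (unfold Re, Im; simpl; ring).
  eapply Rle_trans; [apply Rmax_r|apply Rmax_Cmod].
Qed.

(** The mean value theorem fails for complex values; it is used on the real and
    imaginary parts separately. *)
Lemma path_const (phi : R -> C) :
  (forall t, (0 <= t <= 1)%R -> pderive phi t 0) -> phi 1%R = phi 0%R.
Proof.
intros H.
assert (K : forall g : R -> R, (forall t, (0 <= t <= 1)%R -> is_derive g t 0) -> g 1%R = g 0%R).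
{ intros g Hg.
  destruct (MVT_gen g 0 1 (fun _ => 0%R)) as [c [_ Hc]].
  - intros t; rewrite Rmin_left, Rmax_right by lra; intros; apply Hg; lra.
  - intros t; rewrite Rmin_left, Rmax_right by lra; intros.
    apply continuity_pt_filterlim, (ex_derive_continuous g); exists 0%R; apply Hg; lra.
  - lra. }
rewrite (surjective_pairing (phi 1%R)), (surjective_pairing (phi 0%R)); f_equal.
- apply (K (fun s => Re (phi s))); intros; now apply H.
- apply (K (fun s => Im (phi s))); intros; now apply H.
Qed.

Lemma ray_in_disc (r : R) (x : C) (t : R) :
  (Cmod x < r)%R -> (0 <= t <= 1)%R -> (Cmod (t * x) < r)%R.
Proof.
intros Hx Ht; rewrite Cmod_mult, Cmod_R, Rabs_pos_eq by lra.
pose proof (Cmod_ge_0 x); nra.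
Qed.

Lemma disc_const (f : C -> C) (r : R) :
  (forall x, (Cmod x < r)%R -> cderive f x 0) ->
  forall x, (Cmod x < r)%R -> f x = f 0.
Proof.
intros H x Hx.
assert (E : f (1%R * x) = f (0%R * x)).
{ apply (path_const (fun s => f (s * x))); intros t Ht.
  apply pderive_eq with (0 * x); [|ring].
  now apply pderive_ray, H, ray_in_disc. }
now rewrite Cmult_1_l, Cmult_0_l in E.
Qed.

(** * Finite order of smoothness on a disc *)

(** Every function in play is analytic, but for an equation [x E' + b E = 0]
    only finitely many derivatives matter, and closure under composition is an
    easy induction for this weaker property. *)
Fixpoint smooth (r : R) (n : nat) (f : C -> C) : Prop :=
  match n with
  | O => True
  | S m => exists f' : C -> C,
      (forall x, (Cmod x < r)%R -> cderive f x (f' x)) /\ smooth r m f'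
  end.

Lemma smooth_le (r : R) (n : nat) (f : C -> C) : smooth r (S n) f -> smooth r n f.
Proof.
revert f; induction n as [|n IH]; [easy|].
intros f [f' [H1 H2]]; exists f'; auto.
Qed.

Lemma smooth_const (r : R) (n : nat) (c : C) : smooth r n (fun _ => c).
Proof.
revert c; induction n as [|n IH]; [easy|]; intros c.
exists (fun _ => 0); split; [|apply IH].
intros; apply cderive_const.
Qed.

Lemma smooth_id (r : R) (n : nat) : smooth r n (fun x => x).
Proof.
destruct n; [easy|]; exists (fun _ => 1); split; [|apply smooth_const].
intros; apply cderive_id.
Qed.

Lemma smooth_plus (r : R) (n : nat) (f g : C -> C) :
  smooth r n f -> smooth r n g -> smooth r n (fun x => f x + g x).
Proof.
revert f g; induction n as [|n IH]; [easy|].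
intros f g [f' [Hf Hf']] [g' [Hg Hg']].
exists (fun x => f' x + g' x); split; [|now apply IH].
intros x Hx; apply cderive_plus; auto.
Qed.

Lemma smooth_mult (r : R) (n : nat) (f g : C -> C) :
  smooth r n f -> smooth r n g -> smooth r n (fun x => f x * g x).
Proof.
revert f g; induction n as [|n IH]; [easy|].
intros f g Hf0 Hg0.
pose proof (smooth_le _ _ _ Hf0); pose proof (smooth_le _ _ _ Hg0).
destruct Hf0 as [f' [Hf Hf']]; destruct Hg0 as [g' [Hg Hg']].
exists (fun x => f' x * g x + f x * g' x); split.
- intros x Hx; apply cderive_mult; auto.
- apply smooth_plus; apply IH; trivial.
Qed.

Lemma smooth_comp (r s : R) (n : nat) (f g : C -> C) :
  smooth s n f -> smooth r n g ->
  (forall x, (Cmod x < r)%R -> (Cmod (g x) < s)%R) ->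
  smooth r n (fun x => f (g x)).
Proof.
intros Hf Hg Hs; revert f Hf Hg; induction n as [|n IH]; [easy|].
intros f [f' [Hf Hf']] Hg.
pose proof (smooth_le _ _ _ Hg).
destruct Hg as [g' [Hg Hg']].
exists (fun x => g' x * f' (g x)); split.
- intros x Hx; apply cderive_comp; auto.
- apply smooth_mult; auto.
Qed.

(** * The singular equation x E' + b E = 0 *)

(** Along the ray [t -> t x], [t (|E|^2)' = - 2 Re b |E|^2 <= 0], so [|E|^2] is
    at most its value 0 at the origin. *)
Lemma euler_ode_zero_Re_nonneg (r : R) (b : C) (E : C -> C) :
  (0 <= Re b)%R ->
  (forall x, (Cmod x < r)%R -> exists d, cderive E x d /\ x * d + b * E x = 0) ->
  E 0 = 0 -> forall x, (Cmod x < r)%R -> E x = 0.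
Proof.
intros Hb H E0 x Hx.
set (N := fun t : R => (Re (E (t * x)%C) * Re (E (t * x)%C) + Im (E (t * x)%C) * Im (E (t * x)%C))%R).
assert (HN : forall t, (0 <= t <= 1)%R -> exists d : C,
  t * x * d + b * E (t * x)%C = 0 /\
  is_derive N t (2 * (Re (E (t * x)%C) * Re (d * x) + Im (E (t * x)%C) * Im (d * x)))%R).
{ intros t Ht.
  destruct (H (t * x)) as [d [Hd Hode]]; [now apply ray_in_disc|].
  exists d; split; trivial.
  destruct (pderive_ray _ _ _ _ Hd) as [Hr Hi].
  unfold N.
  replace (2 * (Re (E (t * x)%C) * Re (d * x) + Im (E (t * x)%C) * Im (d * x)))%R with
   ((Re (d * x) * Re (E (t * x)%C) + Re (E (t * x)%C) * Re (d * x)) +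
    (Im (d * x) * Im (E (t * x)%C) + Im (E (t * x)%C) * Im (d * x)))%R by ring.
  apply is_derive_Rplus; now apply is_derive_Rmult. }
destruct (MVT_gen N 0 1 (Derive N)) as [c [Hc Hmvt]].
- intros t; rewrite Rmin_left, Rmax_right by lra; intros Ht.
  apply Derive_correct; destruct (HN t) as [d [_ Hd]]; [lra|eexists; exact Hd].
- intros t; rewrite Rmin_left, Rmax_right by lra; intros Ht.
  apply continuity_pt_filterlim, (ex_derive_continuous N).
  destruct (HN t Ht) as [d [_ Hd]]; eexists; exact Hd.
- rewrite Rmin_left, Rmax_right in Hc by lra.
  destruct (HN c Hc) as [d [Hode Hd]].
  apply is_derive_unique in Hd.
  assert (Hneg : (Derive N c <= 0)%R).
  { destruct (Req_dec c 0) as [->|Hc0].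
    - rewrite Hd, Cmult_0_l, E0; unfold Re, Im; simpl; lra.
    - apply (Rmult_le_reg_l c); [lra|].
      rewrite Hd, Rmult_0_r.
      set (e := E (c * x)%C) in *.
      assert (Hm : c * x * d = - (b * e)) by (replace (c * x * d) with (c * x * d + b * e - b * e) by ring; rewrite Hode; ring).
      replace (c * (2 * (Re e * Re (d * x) + Im e * Im (d * x))))%R with
        (2 * (Re e * Re (c * x * d) + Im e * Im (c * x * d)))%R by (unfold Re, Im; simpl; ring).
      rewrite Hm.
      replace (2 * (Re e * Re (- (b * e)) + Im e * Im (- (b * e))))%R with
        (- 2 * (Re b * (Re e * Re e + Im e * Im e)))%R by (unfold Re, Im; simpl; ring).
      pose proof (Rle_0_sqr (Re e)); pose proof (Rle_0_sqr (Im e)); unfold Rsqr in *.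
      nra. }
  unfold N in Hmvt; rewrite Cmult_0_l, E0, Cmult_1_l in Hmvt.
  set (e := E x) in *.
  assert (H0 : (Re e * Re e + Im e * Im e <= 0)%R).
  { unfold N in Hneg; simpl in Hmvt; unfold Re, Im in *; simpl in *; nra. }
  assert (Re e = 0%R /\ Im e = 0%R) as [H1 H2] by (split; nra).
  destruct e as [e1 e2]; simpl in *; now subst.
Qed.

(** Differentiating the equation gives [x E'' + (b + 1) E' = 0], so that the
    induction on [n] yields [E' = 0]; hence [E] is the constant [E 0].  The
    hypothesis on [b + k] forces the value at 0 of every derivative to vanish;
    [E 0 = 0] has to be assumed, since [b = 0] allows constants. *)
Lemma euler_ode_zero (r : R) (n : nat) (b : C) (E : C -> C) :
  (0 <= INR n + Re b)%R ->
  (forall k : nat, (1 <= k)%nat -> b + INR k <> 0) ->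
  smooth r (S n) E ->
  (forall x d, (Cmod x < r)%R -> cderive E x d -> x * d + b * E x = 0) ->
  E 0 = 0 -> forall x, (Cmod x < r)%R -> E x = 0.
Proof.
revert b E; induction n as [|n IH]; intros b E Hb Hk Hs Hode E0 x Hx.
- apply (euler_ode_zero_Re_nonneg r b); trivial; [simpl in Hb; lra|].
  intros y Hy; destruct Hs as [E' [HE _]].
  exists (E' y); split; auto.
- destruct Hs as [E' [HE [E'' [HE' Hs]]]].
  assert (H1 : forall y d, (Cmod y < r)%R -> cderive E' y d -> y * d + (b + 1) * E' y = 0).
  { intros y d Hy Hd.
    replace (y * d + (b + 1) * E' y) with
      ((1 * E' y + y * d) + (0 * E y + b * E' y)) by ring.
    apply cderive_unique with (f := fun y => y * E' y + b * E y) (z := y).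
    - apply cderive_plus; apply cderive_mult; auto using cderive_id, cderive_const.
    - apply cderive_ext_disc with (f := fun _ => 0) (r := r); trivial;
        [|apply cderive_const].
      intros z Hz; symmetry; apply Hode; auto. }
  assert (H2 : forall y, (Cmod y < r)%R -> E' y = 0).
  { apply IH with (b := b + 1); trivial.
    - rewrite S_INR in Hb; unfold Re in *; simpl; lra.
    - intros k Hk1; specialize (Hk (S k) ltac:(lia)).
      rewrite S_INR, RtoC_plus in Hk; intros E1; apply Hk.
      rewrite <- E1; ring.
    - now exists E''.
    - assert (Hr : (Cmod 0 < r)%R) by (rewrite Cmod_0; pose proof (Cmod_ge_0 x); lra).
      pose proof (H1 0 (E'' 0) Hr (HE' 0 Hr)) as H3.
      rewrite Cmult_0_l, Cplus_0_l in H3.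
      specialize (Hk 1%nat ltac:(lia)); simpl in Hk.
      replace (E' 0) with (/ (b + 1) * ((b + 1) * E' 0)) by (field; trivial).
      rewrite H3; ring. }
  rewrite (disc_const E r); trivial.
  intros y Hy; rewrite <- (H2 y Hy); auto.
Qed.

(** * Complex series *)

Definition Csum (u : nat -> C) (n : nat) : C := sum_n (G := C_NormedModule) u n.
Notation is_Cseries := (is_series (V := C_NormedModule)).

Lemma Csum_S (u : nat -> C) (n : nat) : Csum u (S n) = Csum u n + u (S n).
Proof. exact (sum_Sn (G := C_NormedModule) u n). Qed.

Lemma Csum_0 (u : nat -> C) : Csum u 0 = u 0%nat.
Proof. exact (sum_O (G := C_NormedModule) u). Qed.

Lemma is_Cseries_unique (u : nat -> C) (s t : C) : is_Cseries u s -> is_Cseries u t -> s = t.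
Proof.
exact (filterlim_locally_unique (V := C_NormedModule) (F := eventually) (Csum u) s t).
Qed.

Lemma is_Cseries_eq (u v : nat -> C) (s t : C) :
  is_Cseries u s -> (forall n, u n = v n) -> s = t -> is_Cseries v t.
Proof. intros H E <-; now apply is_series_ext with u. Qed.

Lemma is_Cseries_plus (u v : nat -> C) (s t : C) :
  is_Cseries u s -> is_Cseries v t -> is_Cseries (fun n => u n + v n) (s + t).
Proof. exact (is_series_plus (V := C_NormedModule) u v s t). Qed.

Lemma is_Cseries_scal (c : C) (u : nat -> C) (s : C) :
  is_Cseries u s -> is_Cseries (fun n => c * u n) (c * s).
Proof. exact (is_series_scal (V := C_NormedModule) c u s). Qed.

Lemma is_Cseries_decr (u : nat -> C) (s : C) :
  u 0%nat = 0 -> is_Cseries (fun n => u (S n)) s -> is_Cseries u s.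
Proof.
intros H0 H; apply (is_series_decr_1 (V := C_NormedModule)).
rewrite H0; change (is_Cseries (fun n => u (S n)) (s + - 0)).
now replace (s + - 0) with s by ring.
Qed.

Lemma Csum_Re (u : nat -> C) (n : nat) : Re (Csum u n) = sum_n (fun k => Re (u k)) n.
Proof.
induction n as [|n IH]; [now rewrite Csum_0, sum_O|].
now rewrite Csum_S, sum_Sn, <- IH.
Qed.

Lemma Csum_Im (u : nat -> C) (n : nat) : Im (Csum u n) = sum_n (fun k => Im (u k)) n.
Proof.
induction n as [|n IH]; [now rewrite Csum_0, sum_O|].
now rewrite Csum_S, sum_Sn, <- IH.
Qed.

Definition Cseries (u : nat -> C) : C :=
  (Series (fun n => Re (u n)), Series (fun n => Im (u n))).

Lemma Cseries_correct (u : nat -> C) (b : nat -> R) :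
  (forall n, (Cmod (u n) <= b n)%R) -> ex_series b -> is_Cseries u (Cseries u).
Proof.
intros Hu Hb.
assert (H1 : ex_series (fun n => Re (u n))).
{ apply (ex_series_le (V := R_CompleteNormedModule) _ b); trivial; intros n.
  eapply Rle_trans; [apply re_le_Cmod|apply Hu]. }
assert (H2 : ex_series (fun n => Im (u n))).
{ apply (ex_series_le (V := R_CompleteNormedModule) _ b); trivial; intros n.
  eapply Rle_trans; [|apply Hu].
  eapply Rle_trans; [apply Rmax_r|apply Rmax_Cmod]. }
apply Series_correct in H1; apply Series_correct in H2.
apply (proj2 (filterlim_locally (Csum u) (Cseries u : C_NormedModule))).
intros eps.
pose proof (proj1 (filterlim_locally _ _) H1 eps) as K1.
pose proof (proj1 (filterlim_locally _ _) H2 eps) as K2.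
generalize (filter_and _ _ K1 K2); apply filter_imp.
intros n [B1 B2]; rewrite <- Csum_Re in B1; rewrite <- Csum_Im in B2.
now split.
Qed.

Lemma Csum_Cmod_le (u : nat -> C) (b : nat -> R) (n : nat) :
  (forall k, (Cmod (u k) <= b k)%R) -> (Cmod (Csum u n) <= sum_n b n)%R.
Proof.
intros H; induction n as [|n IH]; [rewrite Csum_0, sum_O; apply H|].
rewrite Csum_S, sum_Sn.
eapply Rle_trans; [apply Cmod_triangle|].
now apply Rplus_le_compat.
Qed.

Lemma is_Cseries_Cmod_le (u : nat -> C) (b : nat -> R) (s : C) :
  (forall n, (Cmod (u n) <= b n)%R) -> ex_series b -> is_Cseries u s ->
  (Cmod s <= Series b)%R.
Proof.
intros Hu Hb Hs.
apply (is_lim_seq_le (fun n => Cmod (Csum u n)) (sum_n b) (Cmod s) (Series b)).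
- intros n; now apply Csum_Cmod_le.
  apply (is_lim_seq_ext (fun n => norm (V := C_NormedModule) (Csum u n))).
  { intros n; reflexivity. }
  exact (filterlim_comp _ _ _ _ _ _ _ _ Hs (filterlim_norm (V := C_NormedModule) s)).
- exact (Series_correct _ Hb).
Qed.

Lemma sum_n_le_Series (b : nat -> R) (n : nat) :
  (forall k, (0 <= b k)%R) -> ex_series b -> (sum_n b n <= Series b)%R.
Proof.
intros H0 Hb.
apply (is_lim_seq_incr_compare (sum_n b) (Series b)).
- exact (Series_correct _ Hb).
- intros k; rewrite sum_Sn; unfold plus; simpl; specialize (H0 (S k)); lra.
Qed.

(** * Complex power series *)

(** The radius of convergence of [c] is at least [r]; phrased by Abel's lemma,
    which makes it directly usable for majorants. *)
Definition converges_in (r : R) (c : nat -> C) : Prop :=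
  forall s : R, (0 < s < r)%R -> exists M : R, forall n, (Cmod (c n) * s ^ n <= M)%R.

Lemma converges_in_term (r : R) (c : nat -> C) (t : R) :
  converges_in r c -> (0 <= t < r)%R ->
  exists M q : R, (0 <= M)%R /\ (0 <= q < 1)%R /\
    forall n, (Cmod (c n) * t ^ n <= M * q ^ n)%R.
Proof.
intros Hc Ht.
set (s := ((t + r) / 2)%R).
destruct (Hc s) as [M HM]; [unfold s; lra|].
assert (Hs : (0 < s)%R) by (unfold s; lra).
exists M, (t / s)%R; repeat split.
- specialize (HM 0%nat); pose proof (Cmod_ge_0 (c 0%nat)); simpl in HM; lra.
- apply Rmult_le_pos; [lra|]; apply Rlt_le, Rinv_0_lt_compat; lra.
- apply (Rmult_lt_reg_r s); trivial; unfold Rdiv.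
  rewrite Rmult_assoc, Rinv_l, Rmult_1_r by lra; unfold s; lra.
- intros n.
  replace (t ^ n)%R with (s ^ n * (t / s) ^ n)%R
    by (rewrite <- Rpow_mult_distr; f_equal; field; lra).
  rewrite <- Rmult_assoc; apply Rmult_le_compat_r; trivial.
  apply pow_le, Rmult_le_pos; [lra|]; apply Rlt_le, Rinv_0_lt_compat; lra.
Qed.

Lemma ex_series_geom_scal (M q : R) : (0 <= q < 1)%R -> ex_series (fun n => M * q ^ n)%R.
Proof.
intros Hq; apply (ex_series_scal (V := R_NormedModule) M).
apply ex_series_geom; rewrite Rabs_pos_eq; lra.
Qed.

Lemma ex_series_Cmod_pow (r : R) (c : nat -> C) (t : R) :
  converges_in r c -> (0 <= t < r)%R -> ex_series (fun n => Cmod (c n) * t ^ n)%R.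
Proof.
intros Hc Ht.
destruct (converges_in_term r c t Hc Ht) as [M [q [HM [Hq H]]]].
apply (ex_series_le (V := R_CompleteNormedModule) _ (fun n => M * q ^ n)%R);
  [|now apply ex_series_geom_scal].
intros n; change (Rabs (Cmod (c n) * t ^ n) <= M * q ^ n)%R.
rewrite Rabs_pos_eq; trivial.
apply Rmult_le_pos; [apply Cmod_ge_0|apply pow_le; lra].
Qed.

Definition CPS (c : nat -> C) (y : C) : C := Cseries (fun n => c n * y ^ n).

Lemma CPS_correct (r : R) (c : nat -> C) (y : C) :
  converges_in r c -> (Cmod y < r)%R -> is_Cseries (fun n => c n * y ^ n) (CPS c y).
Proof.
intros Hc Hy; apply Cseries_correct with (fun n => Cmod (c n) * Cmod y ^ n)%R.
- intros n; rewrite Cmod_mult, Cmod_pow; lra.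
- apply ex_series_Cmod_pow with r; trivial; split; trivial; apply Cmod_ge_0.
Qed.

Lemma CPS_0 (r : R) (c : nat -> C) : (0 < r)%R -> converges_in r c -> CPS c 0 = c 0%nat.
Proof.
intros Hr Hc.
apply is_Cseries_unique with (fun n => c n * 0 ^ n).
- apply CPS_correct with r; trivial; rewrite Cmod_0; lra.
- apply (is_series_decr_1 (V := C_NormedModule)).
  assert (H0 : c 0%nat + - (c 0%nat * 0 ^ 0) = 0) by (simpl; ring).
  change (is_Cseries (fun n => c (S n) * 0 ^ S n) (c 0%nat + - (c 0%nat * 0 ^ 0))).
  rewrite H0.
  apply (filterlim_ext (fun _ : nat => RtoC 0)).
  + intros n; change (RtoC 0 = Csum (fun k => c (S k) * 0 ^ S k) n).
    induction n as [|n IH].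
    * rewrite Csum_0; simpl; ring.
    * rewrite Csum_S, <- IH; simpl; ring.
  + apply filterlim_const.
Qed.

Definition cderiv (c : nat -> C) (n : nat) : C := INR (S n) * c (S n).

(** That is, [(n + 1) q^n <= 1 + q + ... + q^n]. *)
Lemma linear_times_geometric (q : R) (n : nat) :
  (0 <= q < 1)%R -> (INR (S n) * q ^ n * (1 - q) <= 1 - q ^ S n)%R.
Proof.
intros Hq; induction n as [|n IH]; [simpl; lra|].
rewrite S_INR.
assert (Hp : (0 <= q ^ S n <= 1)%R).
{ split; [apply pow_le; lra|].
  rewrite <- (pow1 (S n)); apply pow_incr; lra. }
replace (q ^ S (S n))%R with (q * q ^ S n)%R by (simpl; ring).
set (p := (q ^ S n)%R) in *.
assert (Ep : p = (q * q ^ n)%R) by reflexivity.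
assert ((INR (S n) * p * (1 - q) <= q * (1 - p))%R) by (rewrite Ep at 1; nra).
nra.
Qed.

(** The factor [n + 1] is absorbed by a slight decrease of the radius. *)
Lemma converges_in_cderiv (r : R) (c : nat -> C) :
  converges_in r c -> converges_in r (cderiv c).
Proof.
intros Hc s Hs.
set (t := ((s + r) / 2)%R).
assert (Ht : (s < t < r)%R) by (unfold t; lra).
destruct (Hc t) as [M HM]; [lra|].
set (q := (s / t)%R).
assert (Hq : (0 <= q < 1)%R).
{ split; [apply Rmult_le_pos; [lra|]; apply Rlt_le, Rinv_0_lt_compat; lra|].
  unfold q; apply (Rmult_lt_reg_r t); [lra|].
  unfold Rdiv; rewrite Rmult_assoc, Rinv_l, Rmult_1_r; lra. }
assert (HM0 : (0 <= M)%R).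
{ specialize (HM 0%nat); pose proof (Cmod_ge_0 (c 0%nat)); simpl in HM; lra. }
exists (M / t * / (1 - q))%R; intros n; unfold cderiv.
rewrite Cmod_mult, Cmod_R, Rabs_pos_eq by apply pos_INR.
replace (INR (S n) * Cmod (c (S n)) * s ^ n)%R with
  ((Cmod (c (S n)) * t ^ S n) * / t * (INR (S n) * q ^ n))%R.
2:{ replace (s ^ n)%R with (t ^ n * q ^ n)%R
      by (rewrite <- Rpow_mult_distr; f_equal; unfold q; field; lra).
    simpl; field; lra. }
assert (H1 : (INR (S n) * q ^ n <= / (1 - q))%R).
{ apply (Rmult_le_reg_r (1 - q)); [lra|]; rewrite Rinv_l by lra.
  eapply Rle_trans; [now apply linear_times_geometric|].
  pose proof (pow_le q (S n) (proj1 Hq)); lra. }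
apply Rmult_le_compat; trivial.
- apply Rmult_le_pos; [|apply Rlt_le, Rinv_0_lt_compat; lra].
  apply Rmult_le_pos; [apply Cmod_ge_0|apply pow_le; lra].
- apply Rmult_le_pos; [apply pos_INR|apply pow_le; lra].
- apply Rmult_le_compat_r; [apply Rlt_le, Rinv_0_lt_compat; lra|apply HM].
Qed.

Lemma CPS_euler (r : R) (c : nat -> C) (y : C) :
  converges_in r c -> (Cmod y < r)%R ->
  is_Cseries (fun n => INR n * c n * y ^ n) (y * CPS (cderiv c) y).
Proof.
intros Hc Hy.
apply is_Cseries_decr; [simpl; ring|].
apply is_Cseries_eq with (fun n => y * (cderiv c n * y ^ n)) (y * CPS (cderiv c) y); trivial.
- apply is_Cseries_scal, CPS_correct with r; trivial; now apply converges_in_cderiv.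
- intros n; unfold cderiv; simpl; ring.
Qed.

(** The Taylor remainder of order two of a monomial, bounded by the coefficients
    of a second derivative, so that summing it against a power series gives a
    convergent series. *)
Lemma Cmod_pow_taylor_remainder_le (y h : C) (s : R) (n : nat) :
  (Cmod y + Cmod h <= s)%R ->
  (Cmod ((y + h) ^ S (S n) - y ^ S (S n) - h * (INR (S (S n)) * y ^ S n))
    <= Cmod h * Cmod h * (INR (S (S n)) * INR (S n) * s ^ n))%R.
Proof.
intros Hs.
pose proof (Cmod_ge_0 y); pose proof (Cmod_ge_0 h).
induction n as [|n IH].
- replace ((y + h) ^ 2 - y ^ 2 - h * (INR 2 * y ^ 1)) with (h * h)
    by (rewrite !S_INR, !RtoC_plus; simpl INR; ring).
  rewrite Cmod_mult; simpl; nra.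
- replace ((y + h) ^ S (S (S n)) - y ^ S (S (S n)) - h * (INR (S (S (S n))) * y ^ S (S n)))
   with ((y + h) * ((y + h) ^ S (S n) - y ^ S (S n) - h * (INR (S (S n)) * y ^ S n))
         + INR (S (S n)) * (h * h) * y ^ S n)
    by (rewrite (S_INR (S (S n))), RtoC_plus; simpl Cpow; ring).
  eapply Rle_trans; [apply Cmod_triangle|].
  rewrite !Cmod_mult, Cmod_pow, Cmod_R, Rabs_pos_eq by apply pos_INR.
  set (A := Cmod (_ - _)) in *.
  assert (K1 : (Cmod (y + h) <= s)%R) by (eapply Rle_trans; [apply Cmod_triangle|lra]).
  pose proof (Cmod_ge_0 (y + h)).
  assert (K2 : (Cmod y ^ S n <= s ^ S n)%R) by (apply pow_incr; lra).
  assert (HA : (0 <= A)%R) by apply Cmod_ge_0.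
  pose proof (pos_INR (S (S n))) as Hn.
  set (B := (Cmod h * Cmod h)%R) in *.
  assert (HB : (0 <= B)%R) by (unfold B; nra).
  apply Rle_trans with
    (s * (B * (INR (S (S n)) * INR (S n) * s ^ n)) + INR (S (S n)) * B * s ^ S n)%R.
  + apply Rplus_le_compat.
    * apply Rmult_le_compat; trivial.
    * apply Rmult_le_compat_l; trivial; now apply Rmult_le_pos.
  + assert (Hs0 : (0 <= s ^ n)%R) by (apply pow_le; lra).
    assert (Hx : (0 <= B * (INR (S (S n)) * (s * s ^ n)))%R).
    { apply Rmult_le_pos; trivial; apply Rmult_le_pos; trivial; apply Rmult_le_pos; lra. }
    rewrite (S_INR (S (S n))) in *; rewrite (S_INR (S n)) in *; simpl pow; nra.
Qed.

Lemma cderive_CPS (r : R) (c : nat -> C) (y : C) :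
  converges_in r c -> (Cmod y < r)%R -> cderive (CPS c) y (CPS (cderiv c) y).
Proof.
intros Hc Hy.
pose proof (Cmod_ge_0 y).
set (s := ((Cmod y + r) / 2)%R).
assert (Hs : (Cmod y < s < r)%R) by (unfold s; lra).
(* The majorant of the second order remainders, apart from the factor |h|^2. *)
set (b := fun n => match n with
  | S (S m) => (Cmod (cderiv (cderiv c) m) * s ^ m)%R
  | _ => 0%R end).
assert (Hb : ex_series b).
{ apply (ex_series_incr_1 (V := R_NormedModule)).
  apply (ex_series_incr_1 (V := R_NormedModule)).
  apply ex_series_Cmod_pow with r; [now do 2 apply converges_in_cderiv|lra]. }
assert (Hb0 : forall n, (0 <= b n)%R).
{ intros [|[|n]]; simpl; try lra.
  apply Rmult_le_pos; [apply Cmod_ge_0|apply pow_le; lra]. }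
assert (HB : (0 <= Series b)%R).
{ eapply Rle_trans; [|apply (sum_n_le_Series b 0); trivial].
  rewrite sum_O; apply Hb0. }
apply cderive_eps; intros eps Heps.
exists (Rmin (s - Cmod y) (eps / (Series b + 1)))%R; split.
{ apply Rmin_glb_lt; [lra|]; apply Rdiv_lt_0_compat; lra. }
intros h Hh.
pose proof (Rmin_l (s - Cmod y) (eps / (Series b + 1))).
pose proof (Rmin_r (s - Cmod y) (eps / (Series b + 1))).
pose proof (Cmod_ge_0 h).
apply Rle_trans with (Series (fun n => Cmod h * Cmod h * b n)%R).
- apply is_Cseries_Cmod_le with
    (fun n => c n * ((y + h) ^ n - y ^ n - h * (INR n * y ^ pred n))).
  + intros [|[|n]].
    * replace (c 0%nat * _) with (RtoC 0) by (simpl; ring); rewrite Cmod_0; simpl; lra.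
    * replace (c 1%nat * _) with (RtoC 0) by (simpl; ring); rewrite Cmod_0; simpl; lra.
    * rewrite Cmod_mult; simpl pred; simpl b.
      unfold cderiv; rewrite !Cmod_mult, !Cmod_R, !(Rabs_pos_eq (INR _)) by apply pos_INR.
      pose proof (Cmod_pow_taylor_remainder_le y h s n ltac:(lra)) as HT.
      eapply Rle_trans; [apply Rmult_le_compat_l; [apply Cmod_ge_0|exact HT]|].
      right; ring.
  + apply (ex_series_scal (V := R_NormedModule)); exact Hb.
  + assert (Hyh : (Cmod (y + h) < r)%R) by (eapply Rle_lt_trans; [apply Cmod_triangle|lra]).
    pose proof (CPS_correct r c _ Hc Hyh) as S1.
    pose proof (CPS_correct r c _ Hc Hy) as S2.
    assert (S3 : is_Cseries (fun n => c n * (INR n * y ^ pred n)) (CPS (cderiv c) y)).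
    { apply is_Cseries_decr; [simpl; ring|].
      apply is_Cseries_eq with (fun n => cderiv c n * y ^ n) (CPS (cderiv c) y); trivial.
      - apply CPS_correct with r; trivial; now apply converges_in_cderiv.
      - intros n; unfold cderiv; simpl pred; ring. }
    eapply is_Cseries_eq.
    * exact (is_Cseries_plus _ _ _ _ (is_Cseries_plus _ _ _ _ S1 (is_Cseries_scal (- (1)) _ _ S2))
               (is_Cseries_scal (- h) _ _ S3)).
    * intros n; simpl; ring.
    * ring.
- rewrite Series_scal_l.
  assert (Hx : (Cmod h * (Series b + 1) <= eps)%R).
  { apply (Rmult_le_reg_r (/ (Series b + 1))); [apply Rinv_0_lt_compat; lra|].
    rewrite Rmult_assoc, Rinv_r, Rmult_1_r by lra; unfold Rdiv in *; lra. }
  nra.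
Qed.

Lemma smooth_CPS (r : R) (n : nat) (c : nat -> C) : converges_in r c -> smooth r n (CPS c).
Proof.
revert c; induction n as [|n IH]; [easy|]; intros c Hc.
exists (CPS (cderiv c)); split.
- intros x Hx; now apply cderive_CPS with r.
- apply IH; now apply converges_in_cderiv.
Qed.

Lemma converges_in_geom (c : nat -> C) (M R0 : R) :
  (0 < R0)%R -> (forall n, (Cmod (c n) <= M * R0 ^ n)%R) -> converges_in (/ R0) c.
Proof.
intros HR H s Hs; exists M; intros n.
assert (HM : (0 <= M)%R).
{ specialize (H 0%nat); pose proof (Cmod_ge_0 (c 0%nat)); simpl in H; lra. }
assert (H1 : (R0 * s <= 1)%R).
{ rewrite <- (Rinv_r R0) by lra; apply Rmult_le_compat_l; lra. }
assert (H2 : ((R0 * s) ^ n <= 1)%R).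
{ rewrite <- (pow1 n); apply pow_incr; split; trivial; apply Rmult_le_pos; lra. }
rewrite Rpow_mult_distr in H2.
pose proof (pow_lt s n (proj1 Hs)); specialize (H n); nra.
Qed.

Lemma converges_in_le (r s : R) (c : nat -> C) :
  (s <= r)%R -> converges_in r c -> converges_in s c.
Proof. intros Hsr Hc t Ht; apply Hc; lra. Qed.

Lemma Csum_ext (u v : nat -> C) (n : nat) :
  (forall k, (k <= n)%nat -> u k = v k) -> Csum u n = Csum v n.
Proof. intros H; exact (sum_n_ext_loc (G := C_NormedModule) u v n H). Qed.

Lemma Csum_plus (u v : nat -> C) (n : nat) : Csum (fun k => u k + v k) n = Csum u n + Csum v n.
Proof. exact (sum_n_plus (G := C_NormedModule) u v n). Qed.

Lemma Csum_mult_l (c : C) (u : nat -> C) (n : nat) : Csum (fun k => c * u k) n = c * Csum u n.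
Proof. exact (sum_n_mult_l (K := C_Ring) c u n). Qed.

Lemma sum_n_Rmult_l (a : R) (u : nat -> R) (n : nat) :
  sum_n (fun k => a * u k)%R n = (a * sum_n u n)%R.
Proof. exact (sum_n_mult_l (K := R_Ring) a u n). Qed.

Lemma Csum_indicator (u : nat -> C) (i n : nat) :
  (i <= n)%nat -> Csum (fun k => if (k =? i)%nat then u k else 0) n = u i.
Proof.
intros Hi.
assert (H : forall m, (m < i)%nat -> Csum (fun k => if (k =? i)%nat then u k else 0) m = 0).
{ induction m as [|m IH]; intros Hm.
  - rewrite Csum_0; destruct (Nat.eqb_spec 0 i); [lia|easy].
  - rewrite Csum_S, IH by lia; destruct (Nat.eqb_spec (S m) i); [lia|ring]. }
induction n as [|n IH].
- rewrite Csum_0; destruct (Nat.eqb_spec 0 i) as [<-|]; [easy|lia].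
- rewrite Csum_S; destruct (Nat.eqb_spec (S n) i) as [<-|].
  + rewrite H by lia; ring.
  + rewrite IH by lia; ring.
Qed.

Lemma Csum_truncate (u : nat -> C) (l n : nat) :
  (l <= n)%nat -> Csum (fun k => if (k <=? l)%nat then u k else 0) n = Csum u l.
Proof.
induction n as [|n IH]; intros Hl.
- replace l with 0%nat by lia; now rewrite !Csum_0.
- destruct (Nat.eq_dec l (S n)) as [->|].
  + apply Csum_ext; intros k Hk; now destruct (Nat.leb_spec k (S n)); [|lia].
  + rewrite Csum_S, IH by lia; destruct (Nat.leb_spec (S n) l); [lia|ring].
Qed.

(** * Double series *)

Definition diagonal (u : nat -> nat -> C) (n : nat) : C := Csum (fun j => u j (n - j)%nat) n.

Lemma rectangle_diagonal (u : nat -> nat -> C) (l J K : nat) :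
  (l <= J)%nat -> (l <= K)%nat ->
  Csum (fun j => Csum (fun k => if (j + k =? l)%nat then u j k else 0) K) J = diagonal u l.
Proof.
intros HJ HK; unfold diagonal.
rewrite <- (Csum_truncate _ l J) by trivial.
apply Csum_ext; intros j Hj.
destruct (Nat.leb_spec j l) as [Hl|Hl].
- rewrite <- (Csum_indicator (u j) (l - j) K) by lia.
  apply Csum_ext; intros k Hk.
  destruct (Nat.eqb_spec (j + k) l), (Nat.eqb_spec k (l - j)); trivial; lia.
- rewrite (Csum_ext _ (fun _ => 0 * 0)).
  + rewrite Csum_mult_l; ring.
  + intros k Hk; destruct (Nat.eqb_spec (j + k) l); [lia|ring].
Qed.

Lemma rectangle_triangle (u : nat -> nat -> C) (m J K : nat) :
  (m <= J)%nat -> (m <= K)%nat ->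
  Csum (fun j => Csum (fun k => if (j + k <=? m)%nat then u j k else 0) K) J
  = Csum (diagonal u) m.
Proof.
intros HJ HK; induction m as [|m IH].
- rewrite Csum_0, <- (rectangle_diagonal u 0 J K) by lia.
  apply Csum_ext; intros j _; apply Csum_ext; intros k _.
  destruct (Nat.leb_spec (j + k) 0), (Nat.eqb_spec (j + k) 0); trivial; lia.
- rewrite Csum_S, <- IH, <- (rectangle_diagonal u (S m) J K), <- Csum_plus by lia.
  apply Csum_ext; intros j _; rewrite <- Csum_plus; apply Csum_ext; intros k _.
  destruct (Nat.leb_spec (j + k) (S m)), (Nat.eqb_spec (j + k) (S m)),
    (Nat.leb_spec (j + k) m); try lia; ring.
Qed.

(** A rectangle with both sides at least [m] contains the triangle
    [j + k <= m].  The terms outside the triangle are bounded by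
    [M sqrt(q)^m sqrt(q)^j sqrt(q)^k], since [j + k >= m]; their sum is at most
    a constant times [sqrt(q)^m], uniformly in the rectangle. *)
Lemma is_double_series_diagonal (u : nat -> nat -> C) (M q : R) (s : C) :
  (0 <= q < 1)%R -> (forall j k, (Cmod (u j k) <= M * q ^ (j + k))%R) ->
  is_Cseries (diagonal u) s -> is_double_series u s.
Proof.
intros Hq Hu Hs.
set (t := sqrt q).
assert (Ht : (0 <= t < 1)%R).
{ split; [apply sqrt_pos|]; unfold t; rewrite <- sqrt_1; apply sqrt_lt_1; lra. }
assert (Htt : (t * t = q)%R) by (apply sqrt_sqrt; lra).
assert (HM : (0 <= M)%R).
{ specialize (Hu 0%nat 0%nat); pose proof (Cmod_ge_0 (u 0%nat 0%nat)); simpl in Hu; lra. }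
assert (Hpow : forall n, (0 <= t ^ n)%R) by (intros; apply pow_le; lra).
assert (Hex : ex_series (fun n => t ^ n)%R) by (apply ex_series_geom; rewrite Rabs_pos_eq; lra).
set (G := Series (fun n => t ^ n)%R).
assert (HG : forall n, (sum_n (fun k => t ^ k) n <= G)%R).
{ intros n; now apply sum_n_le_Series. }
assert (HG0 : (0 <= G)%R).
{ eapply Rle_trans; [|apply (HG 0%nat)]; rewrite sum_O; apply Hpow. }
apply (proj2 (filterlim_locally (U := C_NormedModule) _ s)).
intros eps.
assert (Hlim : is_lim_seq (fun m => M * G * G * t ^ m)%R 0).
{ replace (Finite 0) with (Rbar_mult (M * G * G)%R 0) by (simpl; f_equal; ring).
  apply is_lim_seq_scal_l, is_lim_seq_geom; rewrite Rabs_pos_eq; lra. }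
pose proof (proj1 (filterlim_locally (U := C_NormedModule) _ s) Hs (pos_div_2 eps)) as H1.
apply is_lim_seq_spec in Hlim; specialize (Hlim (pos_div_2 eps)).
destruct (filter_and _ _ H1 Hlim) as [m Hm].
destruct (Hm m (Nat.le_refl m)) as [Hm1 Hm2].
apply Filter_prod with (fun J => (m <= J)%nat) (fun K => (m <= K)%nat);
  [now exists m|now exists m|].
intros J K HJ HK; simpl fst; simpl snd.
replace (pos eps) with (pos_div_2 eps + pos_div_2 eps)%R by (simpl; lra).
eapply ball_triangle; [exact Hm1|].
apply (norm_compat1 (V := C_NormedModule)).
change (Cmod (Csum (fun j => Csum (u j) K) J - Csum (diagonal u) m) < pos_div_2 eps)%R.
rewrite <- (rectangle_triangle u m J K) by trivial.
replace (Csum (fun j => Csum (u j) K) J -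
  Csum (fun j => Csum (fun k => if (j + k <=? m)%nat then u j k else 0) K) J)
 with (Csum (fun j => Csum (fun k => if (j + k <=? m)%nat then 0 else u j k) K) J).
2:{ match goal with |- ?x = ?y - ?z => assert (E : y = x + z) end.
    - rewrite <- Csum_plus; apply Csum_ext; intros j _.
      rewrite <- Csum_plus; apply Csum_ext; intros k _.
      destruct (j + k <=? m)%nat; ring.
    - rewrite E; ring. }
eapply Rle_lt_trans with (M * G * G * t ^ m)%R.
2:{ rewrite Rminus_0_r in Hm2; eapply Rle_lt_trans; [apply Rle_abs|exact Hm2]. }
assert (Hterm : forall j k,
  (Cmod (if (j + k <=? m)%nat then 0 else u j k) <= M * t ^ m * t ^ j * t ^ k)%R).
{ intros j k.
  assert (H0 : (0 <= M * t ^ m * t ^ j * t ^ k)%R) by (repeat apply Rmult_le_pos; trivial).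
  destruct (Nat.leb_spec (j + k) m) as [|Hjk]; [now rewrite Cmod_0|].
  eapply Rle_trans; [apply Hu|].
  rewrite <- Htt, Rpow_mult_distr, !Rmult_assoc.
  apply Rmult_le_compat_l; trivial.
  rewrite <- (pow_add t j k); apply Rmult_le_compat_r; trivial.
  replace (j + k)%nat with (m + (j + k - m))%nat by lia.
  rewrite pow_add; rewrite <- (Rmult_1_r (t ^ m)) at 2.
  apply Rmult_le_compat_l; trivial.
  rewrite <- (pow1 (j + k - m)); apply pow_incr; lra. }
eapply Rle_trans; [apply Csum_Cmod_le with (b := fun j => (M * t ^ m * G * t ^ j)%R)|].
- intros j.
  eapply Rle_trans; [apply Csum_Cmod_le; intros k; apply Hterm|].
  rewrite sum_n_Rmult_l.
  replace (M * t ^ m * G * t ^ j)%R with (M * t ^ m * t ^ j * G)%R by ring.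
  apply Rmult_le_compat_l; trivial; repeat apply Rmult_le_pos; trivial.
- rewrite sum_n_Rmult_l.
  replace (M * G * G * t ^ m)%R with (M * t ^ m * G * G)%R by ring.
  apply Rmult_le_compat_l; trivial; repeat apply Rmult_le_pos; trivial.
Qed.

Lemma is_double_series_prod (u v : nat -> C) (s t : C) :
  is_Cseries u s -> is_Cseries v t -> is_double_series (fun j k => u j * v k) (s * t).
Proof.
intros Hu Hv; unfold is_double_series.
apply (filterlim_ext (fun p : nat * nat => Csum u (fst p) * Csum v (snd p))).
{ intros [J K]; simpl fst; simpl snd.
  rewrite Cmult_comm, <- Csum_mult_l; apply Csum_ext; intros j _.
  rewrite Cmult_comm; symmetry; apply Csum_mult_l. }
apply (filterlim_comp_2 (G := locally (T := AbsRing_UniformSpace C_AbsRing) s)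
  (H := locally (T := C_NormedModule) t)
  (fun p : nat * nat => Csum u (fst p)) (fun p : nat * nat => Csum v (snd p))
  (fun a b : C => a * b)).
- apply filterlim_comp with eventually; [apply filterlim_fst|].
  intros P HP; apply Hu; now apply locally_C.
- apply filterlim_comp with eventually; [apply filterlim_snd|exact Hv].
- exact (filterlim_scal (V := C_NormedModule) s t).
Qed.

Lemma is_double_series_unique (u : nat -> nat -> C) (s t : C) :
  is_double_series u s -> is_double_series u t -> s = t.
Proof.
exact (filterlim_locally_unique (V := C_NormedModule)
  (F := filter_prod eventually eventually) _ s t).
Qed.

Lemma INR_le_pow2 (n : nat) : (INR (S n) <= 2 ^ n)%R.
Proof.
induction n as [|n IH]; [simpl; lra|].
rewrite S_INR; simpl pow.
assert (1 <= 2 ^ n)%R by (apply pow_R1_Rle; lra); lra.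
Qed.

Lemma diagonal_Cmod_le (u : nat -> nat -> C) (M q : R) (n : nat) :
  (forall j k, (Cmod (u j k) <= M * q ^ (j + k))%R) ->
  (Cmod (diagonal u n) <= INR (S n) * (M * q ^ n))%R.
Proof.
intros Hu; unfold diagonal.
rewrite (Csum_ext _ (fun j => if (j <=? n)%nat then u j (n - j)%nat else 0)).
2:{ intros k Hk; now destruct (Nat.leb_spec k n); [|lia]. }
assert (H0 : (0 <= M * q ^ n)%R).
{ eapply Rle_trans; [apply (Cmod_ge_0 (u 0%nat n))|apply Hu]. }
eapply Rle_trans; [apply Csum_Cmod_le with (b := fun _ => (M * q ^ n)%R)|].
- intros k; destruct (Nat.leb_spec k n); [|now rewrite Cmod_0].
  eapply Rle_trans; [apply Hu|right].
  now replace (k + (n - k))%nat with n by lia.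
- rewrite sum_n_const; lra.
Qed.

(** Both the sum of the diagonals and the product of the sums are limits of the
    rectangular partial sums. *)
Lemma is_Cseries_Cauchy_product (u v : nat -> C) (M q : R) (s t : C) :
  (0 <= q < 1)%R -> (forall j k, (Cmod (u j * v k) <= M * q ^ (j + k))%R) ->
  is_Cseries u s -> is_Cseries v t ->
  is_Cseries (diagonal (fun j k => u j * v k)) (s * t).
Proof.
intros Hq Huv Hu Hv.
set (D := diagonal (fun j k => u j * v k)).
assert (HD : is_Cseries D (Cseries D)).
{ set (r := sqrt q).
  assert (Hr : (0 <= r < 1)%R).
  { split; [apply sqrt_pos|]; unfold r; rewrite <- sqrt_1; apply sqrt_lt_1; lra. }
  assert (Hrr : (r * r = q)%R) by (apply sqrt_sqrt; lra).
  apply Cseries_correct with (fun n => M / (1 - r) * r ^ n)%R; [|now apply ex_series_geom_scal].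
  intros n; eapply Rle_trans; [apply diagonal_Cmod_le, Huv|].
  rewrite <- Hrr, Rpow_mult_distr.
  assert (HM : (0 <= M)%R).
  { specialize (Huv 0%nat 0%nat); pose proof (Cmod_ge_0 (u 0%nat * v 0%nat)); simpl in Huv; lra. }
  replace (INR (S n) * (M * (r ^ n * r ^ n)))%R with (M * (INR (S n) * r ^ n) * r ^ n)%R by ring.
  apply Rmult_le_compat_r; [apply pow_le; lra|].
  apply Rmult_le_compat_l; trivial.
  apply (Rmult_le_reg_r (1 - r)); [lra|]; rewrite Rinv_l by lra.
  eapply Rle_trans; [now apply linear_times_geometric|].
  pose proof (pow_le r (S n) (proj1 Hr)); lra. }
replace (s * t) with (Cseries D); trivial.
apply is_double_series_unique with (fun j k => u j * v k).
- now apply is_double_series_diagonal with M q.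
- now apply is_double_series_prod.
Qed.

Lemma INR_C_neq0 (n : nat) : RtoC (INR (S n)) <> 0.
Proof. intros E; apply RtoC_inj in E; now apply (not_0_INR (S n)). Qed.

Lemma INR_fact_C_neq0 (n : nat) : RtoC (INR (fact n)) <> 0.
Proof. intros E; apply RtoC_inj in E; now apply (INR_fact_neq_0 n). Qed.

(** * Binomial series *)

Definition binom (b : C) (n : nat) : C := poch b n / INR (fact n).

Lemma cderiv_binom (b : C) (n : nat) : cderiv (binom b) n = (b + INR n) * binom b n.
Proof.
unfold cderiv, binom.
rewrite fact_simpl, mult_INR, RtoC_mult; simpl poch.
field; split; [apply INR_fact_C_neq0|apply INR_C_neq0].
Qed.

Lemma binom_Cmod_le (b : C) (R0 : R) (n : nat) :
  (Cmod b + 1 <= R0)%R -> (Cmod (binom b n) <= R0 ^ n)%R.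
Proof.
intros HR; pose proof (Cmod_ge_0 b).
induction n as [|n IH].
- unfold binom; simpl; replace (1 / 1) with (RtoC 1) by field; rewrite Cmod_1; lra.
- pose proof (pos_INR n).
  apply (Rmult_le_reg_l (INR (S n))); [rewrite S_INR; lra|].
  rewrite <- (Rabs_pos_eq (INR (S n))) at 1 by apply pos_INR.
  rewrite <- Cmod_R, <- Cmod_mult.
  change (Cmod (cderiv (binom b) n) <= INR (S n) * R0 ^ S n)%R.
  rewrite cderiv_binom, Cmod_mult.
  replace (INR (S n) * R0 ^ S n)%R with (INR (S n) * R0 * R0 ^ n)%R by (simpl; ring).
  apply Rmult_le_compat; trivial; try apply Cmod_ge_0.
  eapply Rle_trans; [apply Cmod_triangle|].
  rewrite Cmod_R, Rabs_pos_eq, S_INR by trivial; nra.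
Qed.

Lemma converges_in_binom (b : C) (R0 : R) :
  (Cmod b + 1 <= R0)%R -> converges_in (/ R0) (binom b).
Proof.
intros HR; pose proof (Cmod_ge_0 b).
apply converges_in_geom with 1%R; [lra|].
intros n; rewrite Rmult_1_l; now apply binom_Cmod_le.
Qed.

(** Termwise, [y d/dy + a] multiplies the coefficient of [y^n] by [a + n]. *)
Lemma CPS_linear_ode (r : R) (a : C) (g h : nat -> C) (y : C) :
  converges_in r g -> converges_in r h -> (Cmod y < r)%R ->
  (forall n, (a + INR n) * g n = a * h n) ->
  y * CPS (cderiv g) y + a * CPS g y = a * CPS h y.
Proof.
intros Hg Hh Hy E.
apply is_Cseries_unique with (fun n => a * (h n * y ^ n)).
- eapply is_Cseries_eq.
  + exact (is_Cseries_plus _ _ _ _ (CPS_euler r g y Hg Hy)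
      (is_Cseries_scal a _ _ (CPS_correct r g y Hg Hy))).
  + intros n; simpl; rewrite (Cmult_assoc a (h n)), <- E; ring.
  + reflexivity.
- apply is_Cseries_scal; apply (CPS_correct r); trivial.
Qed.

(** This is [(1 - y)^(-b)], the branch with value 1 at 0. *)
Definition Binom (b : C) : C -> C := CPS (binom b).

(** The recurrence [(n + 1) c (n + 1) = (b + n) c n] in the form [f' = b f + y f']. *)
Lemma Binom_ode (b y : C) (R0 : R) :
  (Cmod b + 1 <= R0)%R -> (Cmod y < / R0)%R ->
  (1 - y) * CPS (cderiv (binom b)) y = b * Binom b y.
Proof.
intros HR Hy.
pose proof (converges_in_binom b R0 HR) as Hc.
assert (E : CPS (cderiv (binom b)) y = b * Binom b y + y * CPS (cderiv (binom b)) y).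
{ apply is_Cseries_unique with (fun n => cderiv (binom b) n * y ^ n).
  - apply CPS_correct with (/ R0)%R; trivial; now apply converges_in_cderiv.
  - eapply is_Cseries_eq.
    + exact (is_Cseries_plus _ _ _ _
        (is_Cseries_scal b _ _ (CPS_correct (/ R0) (binom b) y Hc Hy))
        (CPS_euler (/ R0) (binom b) y Hc Hy)).
    + intros n; simpl; rewrite cderiv_binom; ring.
    + reflexivity. }
replace ((1 - y) * CPS (cderiv (binom b)) y) with
  (CPS (cderiv (binom b)) y - y * CPS (cderiv (binom b)) y) by ring.
rewrite E at 1; ring.
Qed.

Lemma Binom_0 (b : C) : Binom b 0 = 1.
Proof.
pose proof (Cmod_ge_0 b).
unfold Binom; rewrite (CPS_0 (/ (Cmod b + 1))).
- unfold binom; simpl; field.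
- apply Rinv_0_lt_compat; lra.
- apply converges_in_binom; lra.
Qed.

Lemma one_minus_neq0 (y : C) : (Cmod y < 1)%R -> 1 - y <> 0.
Proof.
intros Hy E; assert (Ey : y = 1) by (replace y with (1 - (1 - y)) by ring; rewrite E; ring).
rewrite Ey, Cmod_1 in Hy; lra.
Qed.

Lemma cderive_Binom_comp (b : C) (R0 : R) (g : C -> C) (x g' : C) :
  (Cmod b + 1 <= R0)%R -> cderive g x g' -> (Cmod (g x) < / R0)%R ->
  cderive (fun x => Binom b (g x)) x (b * g' / (1 - g x) * Binom b (g x)).
Proof.
intros HR Hg Hgx; pose proof (Cmod_ge_0 b).
assert (H1 : 1 - g x <> 0).
{ apply one_minus_neq0; eapply Rlt_le_trans; [exact Hgx|].
  rewrite <- Rinv_1; apply Rinv_le_contravar; lra. }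
apply cderive_eq with (g' * CPS (cderiv (binom b)) (g x)).
- apply cderive_comp; trivial.
  apply cderive_CPS with (/ R0)%R; trivial; now apply converges_in_binom.
- replace (CPS (cderiv (binom b)) (g x)) with (b * Binom b (g x) / (1 - g x)).
  + field; trivial.
  + rewrite <- (Binom_ode b (g x) R0) by trivial; field; trivial.
Qed.

Lemma Binom_opp (b x : C) (R0 : R) :
  (Cmod b + 1 <= R0)%R -> (Cmod x < / R0)%R -> Binom b x * Binom (- b) x = 1.
Proof.
intros HR Hx; pose proof (Cmod_ge_0 b).
assert (HR' : (Cmod (- b) + 1 <= R0)%R) by now rewrite Cmod_opp.
rewrite (disc_const (fun x => Binom b x * Binom (- b) x) (/ R0)); trivial.
- rewrite !Binom_0; ring.
- intros y Hy.
  assert (1 - y <> 0).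
  { apply one_minus_neq0; eapply Rlt_le_trans; [exact Hy|].
    rewrite <- Rinv_1; apply Rinv_le_contravar; lra. }
  eapply cderive_eq.
  + apply cderive_mult; apply (cderive_Binom_comp _ R0 (fun x => x) y 1);
      auto using cderive_id.
  + cbv beta; field; trivial.
Qed.

Lemma Binom_1 (x : C) (R0 : R) :
  (2 <= R0)%R -> (Cmod x < / R0)%R -> Binom 1 x = / (1 - x).
Proof.
intros HR Hx.
assert (HR' : (Cmod 1 + 1 <= R0)%R) by (rewrite Cmod_1; lra).
assert (H1 : forall y, (Cmod y < / R0)%R -> 1 - y <> 0).
{ intros y Hy; apply one_minus_neq0; eapply Rlt_le_trans; [exact Hy|].
  rewrite <- Rinv_1; apply Rinv_le_contravar; lra. }
assert (E : (1 + - (1) * x) * Binom 1 x = 1).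
{ rewrite (disc_const (fun x => (1 + - (1) * x) * Binom 1 x) (/ R0)); trivial.
  - rewrite Binom_0; ring.
  - intros y Hy; eapply cderive_eq.
    + apply cderive_mult.
      * apply cderive_plus; [apply cderive_const|].
        apply cderive_mult; [apply cderive_const|apply cderive_id].
      * apply (cderive_Binom_comp _ R0 (fun x => x) y 1); auto using cderive_id.
    + cbv beta; field; auto. }
replace (Binom 1 x) with ((1 + - (1) * x) * Binom 1 x / (1 - x)) by (field; auto).
rewrite E; field; auto.
Qed.

(** * The principal branch of the power of 1 - x *)

Lemma pderive_const (c : C) (t : R) : pderive (fun _ => c) t 0.
Proof.
split; [exact (is_derive_const (V := R_NormedModule) (Re c) t)
       |exact (is_derive_const (V := R_NormedModule) (Im c) t)].
Qed.

Lemma pderive_Cexp (l : R -> C) (t : R) (d : C) :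
  pderive l t d -> pderive (fun s => Cexp (l s)) t (d * Cexp (l t)).
Proof.
intros [Hr Hi].
pose proof (is_derive_comp (V := R_NormedModule) exp (fun s => Re (l s)) t _ _ (is_derive_exp _) Hr) as He.
pose proof (is_derive_comp (V := R_NormedModule) cos (fun s => Im (l s)) t _ _ (is_derive_cos _) Hi) as Hc.
pose proof (is_derive_comp (V := R_NormedModule) sin (fun s => Im (l s)) t _ _ (is_derive_sin _) Hi) as Hs.
split.
- pose proof (is_derive_Rmult _ _ _ _ _ He Hc) as H.
  replace (Re (d * Cexp (l t))) with
   (scal (Re d) (exp (Re (l t))) * cos (Im (l t)) +
    exp (Re (l t)) * scal (Im d) (- sin (Im (l t))))%R; [exact H|].
  unfold scal; simpl; unfold mult; simpl; unfold Re, Im; ring.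
- pose proof (is_derive_Rmult _ _ _ _ _ He Hs) as H.
  replace (Im (d * Cexp (l t))) with
   (scal (Re d) (exp (Re (l t))) * sin (Im (l t)) +
    exp (Re (l t)) * scal (Im d) (cos (Im (l t))))%R; [exact H|].
  unfold scal; simpl; unfold mult; simpl; unfold Re, Im; ring.
Qed.

(** [Clog (1 - s x)], with the argument written by an arctangent so that it can
    be differentiated in [s]; see [log_ray_1]. *)
Definition log_ray (x : C) (s : R) : C :=
  ((/ 2 * ln ((1 - s * Re x) * (1 - s * Re x) + (s * Im x) * (s * Im x)))%R,
   atan (- (s * Im x) / (1 - s * Re x))).

Lemma Carg_atan (z : C) : (0 < Re z)%R -> Carg z = atan (Im z / Re z).
Proof.
intros Hz.
assert (Hz0 : z <> 0) by (intros ->; simpl in Hz; lra).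
assert (Hp : (0 < Cmod z)%R) by now apply Cmod_gt_0.
assert (Hq : (0 < Re z / Cmod z)%R) by (apply Rdiv_lt_0_compat; lra).
assert (Hs : (sqrt (1 - (Re z / Cmod z)²) / (Re z / Cmod z) = Rabs (Im z) / Re z)%R).
{ replace (1 - (Re z / Cmod z)²)%R with ((Im z / Cmod z)²).
  - rewrite sqrt_Rsqr_abs; unfold Rdiv; rewrite Rabs_mult, (Rabs_pos_eq (/ Cmod z)).
    + field; lra.
    + apply Rlt_le, Rinv_0_lt_compat; lra.
  - pose proof (Cmod2_alt z) as H2; unfold Rsqr.
    apply (Rmult_eq_reg_r (Cmod z ^ 2)); [|nra].
    transitivity (Im z ^ 2)%R; [field; lra|].
    transitivity (Cmod z ^ 2 - Re z ^ 2)%R; [rewrite H2; ring|field; lra]. }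
unfold Carg; rewrite acos_atan, Hs by trivial.
destruct (Rle_dec 0 (Im z)) as [h|h].
- now rewrite Rabs_pos_eq.
- rewrite Rabs_left, <- atan_opp by lra; f_equal; field; lra.
Qed.

Lemma log_ray_1 (x : C) : (Cmod x < 1)%R -> log_ray x 1 = Clog (1 - x).
Proof.
intros Hx.
pose proof (re_le_Cmod x) as Hr; apply Rabs_le_between in Hr.
assert (Hpos : (0 < Re (1 - x))%R) by (unfold Re in *; simpl; lra).
unfold log_ray, Clog; f_equal.
- unfold Cmod.
  rewrite <- Rpower_sqrt.
  2:{ unfold Re in *; simpl in *; nra. }
  unfold Rpower; rewrite ln_exp; do 2 f_equal; unfold Re, Im; simpl; ring.
- rewrite Carg_atan by trivial; f_equal; unfold Re, Im; simpl; f_equal; ring.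
Qed.

Lemma pderive_log_ray (x : C) (t : R) :
  (Cmod x < 1)%R -> (0 <= t <= 1)%R -> pderive (log_ray x) t (- x / (1 - t * x)).
Proof.
intros Hx Ht.
pose proof (re_le_Cmod x) as Hr; apply Rabs_le_between in Hr.
destruct x as [u v]; unfold Re in Hr; simpl in Hr.
assert (Hu : (0 < 1 - t * u)%R) by nra.
assert (Hn : (0 < (1 - t * u) * (1 - t * u) + t * v * (t * v))%R) by nra.
split; unfold log_ray; simpl.
- unfold Re, Im; simpl.
  auto_derive; [repeat split; lra|].
  field; nra.
- unfold Re, Im; simpl.
  auto_derive; [repeat split; lra|].
  unfold Rsqr; field; repeat split; nra.
Qed.

(** The product of [(1 - s x)^(-2a)], in the principal branch, and the square of
    [Binom (- a) (s x)] has derivative 0 in [s] and is 1 at [s = 0]. *)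
Lemma Cpower_Binom (a x : C) (R0 : R) :
  (Cmod a + 1 <= R0)%R -> (Cmod x < / R0)%R ->
  Cpower (1 - x) (- (2 * a)) = Binom a x * Binom a x.
Proof.
intros HR Hx; pose proof (Cmod_ge_0 a).
assert (Hx1 : (Cmod x < 1)%R).
{ eapply Rlt_le_trans; [exact Hx|]; rewrite <- Rinv_1; apply Rinv_le_contravar; lra. }
assert (HR' : (Cmod (- a) + 1 <= R0)%R) by now rewrite Cmod_opp.
pose proof (Binom_opp a x R0 HR Hx) as Hinv.
set (P := fun s : R => Cexp (- (2 * a) * log_ray x s) * (Binom (- a) (s * x) * Binom (- a) (s * x))).
assert (E : P 1%R = P 0%R).
{ apply path_const; intros t Ht.
  pose proof (ray_in_disc _ _ _ Hx Ht) as Htx.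
  pose proof (ray_in_disc _ _ _ Hx1 Ht) as Htx1.
  assert (HB : pderive (fun s => Binom (- a) (s * x)) t
      (- a * 1 / (1 - t * x) * Binom (- a) (t * x)%C * x)).
  { apply (pderive_ray (Binom (- a)) x t).
    apply (cderive_Binom_comp (- a) R0 (fun y => y)); trivial; apply cderive_id. }
  eapply pderive_eq.
  - apply pderive_mult; [apply pderive_Cexp, pderive_mult|apply pderive_mult; exact HB].
    + apply pderive_const.
    + now apply pderive_log_ray.
  - cbv beta; field; now apply one_minus_neq0. }
unfold P in E; rewrite Cmult_1_l, Cmult_0_l, Binom_0, log_ray_1 in E by trivial.
assert (E0 : log_ray x 0 = 0).
{ unfold log_ray; rewrite !Rmult_0_l, Rminus_0_r, Rmult_1_l, Rplus_0_r, ln_1.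
  replace (- 0 / 1)%R with 0%R by field; rewrite atan_0, Rmult_0_r; reflexivity. }
assert (Ee : Cexp (- (2 * a) * log_ray x 0) = 1).
{ rewrite E0, Cmult_0_r; unfold Cexp; simpl; rewrite exp_0, cos_0, sin_0.
  unfold RtoC; f_equal; ring. }
rewrite Ee in E.
change (Cexp (- (2 * a) * Clog (1 - x))) with (Cpower (1 - x) (- (2 * a))) in E.
replace (Cpower (1 - x) (- (2 * a))) with
  (Cpower (1 - x) (- (2 * a)) * (Binom (- a) x * Binom (- a) x)
    * (Binom a x * Binom a x)
   + Cpower (1 - x) (- (2 * a)) * (1 - (Binom a x * Binom (- a) x)) * (1 + (Binom a x * Binom (- a) x))) by ring.
rewrite E, Hinv; ring.
Qed.

(** * The Gauss and Appell series with lower parameter a + 1 *)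

(** Equal to [a / (a + n)], except that this quotient has no meaning for
    [a = n = 0], where the value is 1. *)
Definition ratio (a : C) (n : nat) : C := poch a n / poch (a + 1) n.

Definition admissible (a : C) : Prop := forall n : nat, (1 <= n)%nat -> a + INR n <> 0.

Lemma poch_succ_neq0 (a : C) (n : nat) : admissible a -> poch (a + 1) n <> 0.
Proof.
intros Ha; induction n as [|n IH]; simpl poch; [exact C1_nz|].
apply Cmult_neq_0; trivial.
specialize (Ha (S n) ltac:(lia)); rewrite S_INR, RtoC_plus in Ha.
intros E; apply Ha; rewrite <- E; ring.
Qed.

Lemma ratio_spec (a : C) (n : nat) : admissible a -> (a + INR n) * ratio a n = a.
Proof.
intros Ha.
assert (E : poch a n * (a + INR n) = a * poch (a + 1) n).
{ clear Ha; induction n as [|n IH]; [simpl; ring|].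
  simpl poch; rewrite IH, S_INR, RtoC_plus; ring. }
pose proof (poch_succ_neq0 a n Ha).
unfold ratio; replace ((a + INR n) * (poch a n / poch (a + 1) n)) with
  (poch a n * (a + INR n) / poch (a + 1) n) by (field; trivial).
rewrite E; field; trivial.
Qed.

(** [|a + n| >= 1] for large [n], and finitely many values remain. *)
Lemma ratio_bounded (a : C) : admissible a ->
  exists Q : R, forall n, (Cmod (ratio a n) <= Q)%R.
Proof.
intros Ha.
assert (Hfin : forall (u : nat -> R) (N : nat) (M : R),
  (forall n, (N <= n)%nat -> (u n <= M)%R) -> exists Q : R, forall n, (u n <= Q)%R).
{ intros u N; induction N as [|N IH]; intros M HM.
  - exists M; intros n; apply HM; lia.
  - apply (IH (Rmax M (u N))); intros n Hn.
    destruct (Nat.eq_dec n N) as [->|]; [apply Rmax_r|].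
    eapply Rle_trans; [apply HM; lia|apply Rmax_l]. }
destruct (INR_unbounded (Cmod a + 1)) as [N HN].
apply (Hfin _ N (Cmod a)); intros n Hn.
apply le_INR in Hn.
assert (H1 : (1 <= Cmod (a + INR n))%R).
{ assert (H : (INR n <= Cmod (a + INR n) + Cmod a)%R).
  { rewrite <- (Cmod_opp a), <- (Rabs_pos_eq (INR n)), <- Cmod_R at 1 by apply pos_INR.
    replace (RtoC (INR n)) with ((a + INR n) + - a) at 1 by ring.
    apply Cmod_triangle. }
  lra. }
rewrite <- (ratio_spec a n Ha) at 2; rewrite Cmod_mult.
pose proof (Cmod_ge_0 (ratio a n)); nra.
Qed.

Lemma admissible_not_nonpos (a : C) : admissible a -> ~ nonpos_integer (a + 1).
Proof.
intros Ha [n E]; apply (Ha (S n)); [lia|].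
rewrite S_INR, RtoC_plus; replace (a + (INR n + 1)) with (a + 1 + INR n) by ring.
rewrite E; ring.
Qed.

Lemma converges_in_ratio (a : C) (c : nat -> C) (M R0 : R) :
  admissible a -> (0 < R0)%R -> (forall n, (Cmod (c n) <= M * R0 ^ n)%R) ->
  converges_in (/ R0) (fun n => ratio a n * c n).
Proof.
intros Ha HR Hc.
destruct (ratio_bounded a Ha) as [Q HQ].
apply converges_in_geom with (Q * M)%R; trivial; intros n.
rewrite Cmod_mult, Rmult_assoc.
apply Rmult_le_compat; trivial; apply Cmod_ge_0.
Qed.

Lemma converges_in_hyp2F1 (a b : C) (R0 : R) :
  admissible a -> (Cmod b + 1 <= R0)%R ->
  converges_in (/ R0) (fun n => ratio a n * binom b n).
Proof.
intros Ha HR; pose proof (Cmod_ge_0 b).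
apply converges_in_ratio with 1%R; trivial; [lra|].
intros n; rewrite Rmult_1_l; now apply binom_Cmod_le.
Qed.

Lemma is_hyp2F1_succ (a b z : C) (R0 : R) :
  admissible a -> (Cmod b + 1 <= R0)%R -> (Cmod z < / R0)%R ->
  is_hyp2F1 a b (a + 1) z (CPS (fun n => ratio a n * binom b n) z).
Proof.
intros Ha HR Hz; pose proof (Cmod_ge_0 b).
split; [now apply admissible_not_nonpos|split].
- eapply Rlt_le_trans; [exact Hz|]; rewrite <- Rinv_1; apply Rinv_le_contravar; lra.
- eapply is_Cseries_eq; [apply (CPS_correct (/ R0)); [|exact Hz]|..].
  + exact (converges_in_hyp2F1 a b R0 Ha HR).
  + intros n; unfold ratio, binom, Cdiv; ring.
  + reflexivity.
Qed.

(** The coefficients of [(1 - p y)^(-b1) (1 - q y)^(-b2)] as a series in [y]. *)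
Definition binom2 (b1 b2 p q : C) : nat -> C :=
  diagonal (fun j k => (binom b1 j * p ^ j) * (binom b2 k * q ^ k)).

Lemma binom2_term_Cmod_le (b1 b2 X Y : C) (R0 L : R) (j k : nat) :
  (Cmod b1 + 1 <= R0)%R -> (Cmod b2 + 1 <= R0)%R -> (Cmod X <= L)%R -> (Cmod Y <= L)%R ->
  (Cmod ((binom b1 j * X ^ j) * (binom b2 k * Y ^ k)) <= (R0 * L) ^ (j + k))%R.
Proof.
intros H1 H2 HX HY.
rewrite pow_add, !Rpow_mult_distr, !Cmod_mult, !Cmod_pow.
pose proof (Cmod_ge_0 X); pose proof (Cmod_ge_0 Y).
apply Rmult_le_compat.
- apply Rmult_le_pos; [apply Cmod_ge_0|now apply pow_le].
- apply Rmult_le_pos; [apply Cmod_ge_0|now apply pow_le].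
- apply Rmult_le_compat; [apply Cmod_ge_0|now apply pow_le|now apply binom_Cmod_le|].
  now apply pow_incr.
- apply Rmult_le_compat; [apply Cmod_ge_0|now apply pow_le|now apply binom_Cmod_le|].
  now apply pow_incr.
Qed.

Lemma diagonal_homogeneous (u v : nat -> nat -> C) (y : C) (n : nat) :
  (forall j k, v j k = u j k * y ^ (j + k)) -> diagonal v n = diagonal u n * y ^ n.
Proof.
intros H; unfold diagonal; rewrite Cmult_comm, <- Csum_mult_l.
apply Csum_ext; intros j Hj; rewrite H.
replace (j + (n - j))%nat with n by lia; ring.
Qed.

(** The number [R0] bounds the growth of the binomial coefficients and [L] the
    two directions, so both binomial series converge for [|y| < 1 / (R0 L)].
    The factor 2 in the radius absorbs the number [n + 1 <= 2^n] of terms on a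
    diagonal. *)
Section Appell.
Context (b1 b2 p q : C) (R0 L : R)
  (H1 : (Cmod b1 + 1 <= R0)%R) (H2 : (Cmod b2 + 1 <= R0)%R)
  (Hp : (Cmod p <= L)%R) (Hq : (Cmod q <= L)%R) (HL : (1 <= L)%R).

Lemma binom2_Cmod_le (n : nat) : (Cmod (binom2 b1 b2 p q n) <= 1 * (2 * R0 * L) ^ n)%R.
Proof.
pose proof (Cmod_ge_0 b1).
eapply Rle_trans.
- apply diagonal_Cmod_le with (M := 1%R) (q := (R0 * L)%R).
  intros j k; rewrite Rmult_1_l; now apply binom2_term_Cmod_le.
- rewrite !Rmult_1_l, (Rmult_assoc 2), (Rpow_mult_distr 2).
  apply Rmult_le_compat_r; [apply pow_le; nra|apply INR_le_pow2].
Qed.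

Lemma converges_in_binom2 : converges_in (/ (2 * R0 * L)) (binom2 b1 b2 p q).
Proof.
pose proof (Cmod_ge_0 b1).
apply converges_in_geom with 1%R; [nra|apply binom2_Cmod_le].
Qed.

Lemma converges_in_appellF1 (a : C) :
  admissible a -> converges_in (/ (2 * R0 * L)) (fun n => ratio a n * binom2 b1 b2 p q n).
Proof.
intros Ha; pose proof (Cmod_ge_0 b1).
apply converges_in_ratio with 1%R; trivial; [nra|apply binom2_Cmod_le].
Qed.

Context (y : C) (Hy : (Cmod y < / (2 * R0 * L))%R).

Lemma small_radius : (R0 * (L * Cmod y) < 1 / 2)%R.
Proof.
pose proof (Cmod_ge_0 b1); pose proof (Cmod_ge_0 y).
assert (HRL : (0 < 2 * R0 * L)%R) by nra.
apply (Rmult_lt_compat_l _ _ _ HRL) in Hy; rewrite Rinv_r in Hy by lra; lra.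
Qed.

Lemma small_argument (w : C) : (Cmod w <= L)%R -> (Cmod (w * y) < / R0)%R.
Proof.
intros Hw; pose proof small_radius; pose proof (Cmod_ge_0 b1); pose proof (Cmod_ge_0 y).
rewrite Cmod_mult; apply (Rmult_lt_reg_l R0); [lra|].
rewrite Rinv_r by lra.
apply Rle_lt_trans with (R0 * (L * Cmod y))%R; [|lra].
apply Rmult_le_compat_l; [lra|]; now apply Rmult_le_compat_r.
Qed.

Lemma CPS_binom2 : CPS (binom2 b1 b2 p q) y = Binom b1 (p * y) * Binom b2 (q * y).
Proof.
pose proof small_radius as Hs; pose proof (Cmod_ge_0 b1); pose proof (Cmod_ge_0 y).
apply is_Cseries_unique with (fun n => binom2 b1 b2 p q n * y ^ n).
- apply (CPS_correct (/ (2 * R0 * L))); trivial; apply converges_in_binom2.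
- apply is_Cseries_eq with
    (diagonal (fun j k => (binom b1 j * (p * y) ^ j) * (binom b2 k * (q * y) ^ k)))
    (Binom b1 (p * y) * Binom b2 (q * y)); trivial.
  + apply (is_Cseries_Cauchy_product (fun j => binom b1 j * (p * y) ^ j)
      (fun k => binom b2 k * (q * y) ^ k) 1 (R0 * (L * Cmod y))).
    * split; [|lra]; repeat apply Rmult_le_pos; lra.
    * intros j k; rewrite Rmult_1_l; apply binom2_term_Cmod_le; trivial;
        rewrite Cmod_mult; now apply Rmult_le_compat_r.
    * apply (CPS_correct (/ R0)); [now apply converges_in_binom|now apply small_argument].
    * apply (CPS_correct (/ R0)); [now apply converges_in_binom|now apply small_argument].
  + intros n; apply diagonal_homogeneous; intros j k.
    rewrite !Cpow_mult_l, Cpow_add_r; ring.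
Qed.

(** On the line through [(p, q)], the sum over the diagonal [j + k = n] is
    [y^n] times a coefficient in which the factor [(a)_n / (a+1)_n] comes out. *)
Lemma is_appellF1_ray (a : C) : admissible a ->
  is_appellF1 a b1 b2 (a + 1) (p * y) (q * y)
    (CPS (fun n => ratio a n * binom2 b1 b2 p q n) y).
Proof.
intros Ha.
pose proof small_radius as Hs; pose proof (Cmod_ge_0 b1); pose proof (Cmod_ge_0 y).
assert (HR : (/ R0 <= 1)%R) by (rewrite <- Rinv_1; apply Rinv_le_contravar; lra).
split; [now apply admissible_not_nonpos|split; [|split]].
- eapply Rlt_le_trans; [now apply small_argument|trivial].
- eapply Rlt_le_trans; [now apply small_argument|trivial].
- destruct (ratio_bounded a Ha) as [Q HQ].
  apply is_double_series_diagonal with Q (R0 * (L * Cmod y))%R.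
  + split; [|lra]; repeat apply Rmult_le_pos; lra.
  + intros j k.
    replace (_ * _ * _ * _) with
      (ratio a (j + k) * ((binom b1 j * (p * y) ^ j) * (binom b2 k * (q * y) ^ k)))
      by (unfold ratio, binom; field; repeat split;
          [apply INR_fact_C_neq0|apply INR_fact_C_neq0|now apply poch_succ_neq0]).
    rewrite Cmod_mult; apply Rmult_le_compat; trivial; try apply Cmod_ge_0.
    apply binom2_term_Cmod_le; trivial; rewrite Cmod_mult; now apply Rmult_le_compat_r.
  + eapply is_Cseries_eq;
      [exact (CPS_correct (/ (2 * R0 * L)) _ y (converges_in_appellF1 a Ha) Hy)| |reflexivity].
    intros n; cbv beta.
    unfold binom2; rewrite <- Cmult_assoc.
    rewrite <- (diagonal_homogeneous _
      (fun j k => (binom b1 j * (p * y) ^ j) * (binom b2 k * (q * y) ^ k))).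
    2:{ intros j k; rewrite !Cpow_mult_l, Cpow_add_r; ring. }
    unfold diagonal; rewrite <- Csum_mult_l; apply Csum_ext; intros j Hj.
    replace (j + (n - j))%nat with n by lia.
    unfold ratio, binom; field; repeat split;
      [apply INR_fact_C_neq0|apply INR_fact_C_neq0|now apply poch_succ_neq0].
Qed.
End Appell.

(** * The cubic transformation *)

Definition cubic_arg (x : C) : C := (x / (x - 1)) ^ 3.

(** A form without division, from which smoothness and the derivative are read
    off. *)
Lemma Binom_1_cube (x : C) :
  (Cmod x < / 2)%R -> (- (1) * (x * Binom 1 x)) ^ 3 = cubic_arg x.
Proof.
intros Hx; unfold cubic_arg.
rewrite (Binom_1 x 2) by (trivial; lra).
assert (1 - x <> 0) by (apply one_minus_neq0; lra).
assert (x - 1 <> 0) by (intros E; apply H; replace (1 - x) with (- (x - 1)) by ring; rewrite E; ring).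
f_equal; field; auto.
Qed.

Lemma smooth_ext (r : R) (n : nat) (f g : C -> C) :
  (forall x, (Cmod x < r)%R -> f x = g x) -> smooth r n f -> smooth r n g.
Proof.
destruct n as [|n]; [easy|]; intros E [f' [Hf Hf']].
exists f'; split; trivial; intros x Hx.
apply cderive_ext_disc with f r; auto.
Qed.

Lemma smooth_cubic_arg (r : R) (n : nat) : (r <= / 2)%R -> smooth r n cubic_arg.
Proof.
intros Hr.
apply smooth_ext with (fun x => (- (1) * (x * Binom 1 x)) ^ 3).
{ intros x Hx; apply Binom_1_cube; lra. }
assert (H : smooth r n (fun x => - (1) * (x * Binom 1 x))).
{ apply smooth_mult; [apply smooth_const|].
  apply smooth_mult; [apply smooth_id|].
  apply smooth_CPS, converges_in_le with (/ 2)%R; trivial.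
  apply converges_in_binom; rewrite Cmod_1; lra. }
apply smooth_mult; trivial; apply smooth_mult; trivial.
apply smooth_mult; trivial; apply smooth_const.
Qed.

Lemma cderive_cubic_arg (x : C) :
  (Cmod x < / 2)%R -> cderive cubic_arg x (- (3) * x ^ 2 / (1 - x) ^ 4).
Proof.
intros Hx.
apply cderive_ext_disc with (fun x => (- (1) * (x * Binom 1 x)) ^ 3) (/ 2)%R; trivial.
{ exact Binom_1_cube. }
assert (1 - x <> 0) by (apply one_minus_neq0; lra).
assert (H1 : cderive (fun x => - (1) * (x * Binom 1 x)) x (- (1) / (1 - x) ^ 2)).
{ eapply cderive_eq.
  - apply cderive_mult; [apply cderive_const|].
    apply cderive_mult; [apply cderive_id|].
    apply (cderive_Binom_comp 1 2 (fun y => y)); [rewrite Cmod_1; lra|apply cderive_id|trivial].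
  - cbv beta; rewrite (Binom_1 x 2) by (trivial; lra); field; trivial. }
eapply cderive_eq.
- apply cderive_mult; [exact H1|apply cderive_mult; [exact H1|]].
  apply cderive_mult; [exact H1|apply cderive_const].
- cbv beta; rewrite (Binom_1 x 2) by (trivial; lra); simpl Cpow; field; trivial.
Qed.

Lemma cderive_parabola (x : C) : cderive (fun x => x * (1 + - (1) * x)) x (1 - 2 * x).
Proof.
eapply cderive_eq.
- apply cderive_mult; [apply cderive_id|].
  apply cderive_plus; [apply cderive_const|].
  apply cderive_mult; [apply cderive_const|apply cderive_id].
- cbv beta; ring.
Qed.

Lemma Cmod_moebius_le (x : C) : (Cmod x < / 2)%R -> (Cmod (x / (x - 1)) <= 2 * Cmod x)%R.
Proof.
intros Hx.
assert (H1 : (/ 2 <= Cmod (x - 1))%R).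
{ assert (H : (Cmod 1 <= Cmod (x - 1) + Cmod x)%R).
  { replace (RtoC 1) with (- (x - 1) + x) at 1 by ring.
    eapply Rle_trans; [apply Cmod_triangle|rewrite Cmod_opp; lra]. }
  rewrite Cmod_1 in H; lra. }
assert (x - 1 <> 0) by (apply Cmod_gt_0; lra).
rewrite Cmod_div by trivial.
apply (Rmult_le_reg_r (Cmod (x - 1))); [lra|].
unfold Rdiv; rewrite Rmult_assoc, Rinv_l, Rmult_1_r by lra.
pose proof (Cmod_ge_0 x); nra.
Qed.

(** The number [R0] is at least [|c| + 1] for every exponent [c] in use, so every
    binomial series converges for [|y| < 1 / R0]; the radius [delta] keeps all
    the arguments in that disc, and [p] in the smaller disc of the Appell
    series. *)
Section Identity.
Context (a : C) (Ha : admissible a).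
Let R0 : R := (Cmod a + 2)%R.
Let delta : R := (/ (32 * R0))%R.
Let b : C := 2 / 3 * a.
Let P (x : C) : C := x * (1 + - (1) * x).

Lemma R0_ge_2 : (2 <= R0)%R.
Proof. unfold R0; pose proof (Cmod_ge_0 a); lra. Qed.

Lemma delta_bounds : (0 < delta)%R /\ (R0 * delta = / 32)%R /\ (delta <= / 64)%R.
Proof.
pose proof R0_ge_2.
assert (0 < delta)%R by (apply Rinv_0_lt_compat; lra).
assert (R0 * delta = / 32)%R by (unfold delta; field; lra).
repeat split; trivial; nra.
Qed.

Lemma in_disc_R0 (y : C) (c : R) (x : C) :
  (Cmod x < delta)%R -> (Cmod y <= c * Cmod x)%R -> (0 <= c <= 32)%R -> (Cmod y < / R0)%R.
Proof.
intros Hx Hy Hc.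
pose proof R0_ge_2; destruct delta_bounds as [Hr [Hr1 Hr2]]; pose proof (Cmod_ge_0 x).
apply (Rmult_lt_reg_l R0); [lra|]; rewrite Rinv_r by lra.
assert (Hy' : (Cmod y <= 32 * Cmod x)%R) by nra.
apply Rle_lt_trans with (32 * (R0 * Cmod x))%R.
{ apply (Rmult_le_compat_l R0) in Hy'; lra. }
assert (R0 * Cmod x < R0 * delta)%R by (apply Rmult_lt_compat_l; lra).
lra.
Qed.

Lemma P_small (x : C) : (Cmod x < delta)%R -> (Cmod (P x) <= 2 * Cmod x)%R.
Proof.
intros Hx; destruct delta_bounds as [Hr [Hr1 Hr2]]; pose proof (Cmod_ge_0 x).
assert (H1 : (Cmod (1 + - (1) * x) <= 2)%R).
{ eapply Rle_trans; [apply Cmod_triangle|].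
  rewrite Cmod_mult, Cmod_opp, Cmod_1; lra. }
unfold P; rewrite Cmod_mult; nra.
Qed.

Lemma in_disc_id (x : C) : (Cmod x < delta)%R -> (Cmod x < / R0)%R.
Proof. intros Hx; apply (in_disc_R0 x 1 x); trivial; lra. Qed.

Lemma in_disc_P (c : R) (x : C) :
  (0 <= c <= 4)%R -> (Cmod x < delta)%R -> (Cmod (c * P x) < / R0)%R.
Proof.
intros Hc Hx; pose proof (P_small x Hx); pose proof (Cmod_ge_0 (P x)).
apply (in_disc_R0 _ 8 x); trivial; [|lra].
rewrite Cmod_mult, Cmod_R, Rabs_pos_eq by lra; nra.
Qed.

Lemma in_disc_cubic (x : C) : (Cmod x < delta)%R -> (Cmod (cubic_arg x) < / R0)%R.
Proof.
intros Hx; destruct delta_bounds as [Hr [Hr1 Hr2]]; pose proof (Cmod_ge_0 x).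
pose proof (Cmod_moebius_le x ltac:(lra)) as Hz.
apply (in_disc_R0 _ 2 x); trivial; [|lra].
unfold cubic_arg; rewrite Cmod_pow.
set (z := Cmod (x / (x - 1))) in *; assert (0 <= z)%R by apply Cmod_ge_0.
simpl; assert (z <= 1)%R by lra.
assert (z * z <= 1)%R by nra. nra.
Qed.

Lemma in_disc_P_appell (x : C) : (Cmod x < delta)%R -> (Cmod (P x) < / (2 * R0 * 4))%R.
Proof.
intros Hx; pose proof (P_small x Hx).
pose proof R0_ge_2; destruct delta_bounds as [Hr [Hr1 Hr2]].
apply (Rmult_lt_reg_l (2 * R0 * 4)); [lra|]; rewrite Rinv_r by lra.
apply Rle_lt_trans with (16 * (R0 * Cmod x))%R.
{ apply (Rmult_le_compat_l R0) in H; lra. }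
assert (R0 * Cmod x < R0 * delta)%R by (apply Rmult_lt_compat_l; lra).
lra.
Qed.

Lemma Cmod_a_le : (Cmod a + 1 <= R0)%R. Proof. unfold R0; lra. Qed.
Lemma Cmod_opp_a_le : (Cmod (- a) + 1 <= R0)%R. Proof. rewrite Cmod_opp; apply Cmod_a_le. Qed.
Lemma Cmod_b_le : (Cmod b + 1 <= R0)%R.
Proof.
unfold b; replace (2 / 3) with (RtoC (2 / 3)%R) by (now rewrite RtoC_div by lra).
rewrite Cmod_mult, Cmod_R, Rabs_pos_eq by lra.
unfold R0; pose proof (Cmod_ge_0 a); lra.
Qed.
Lemma Cmod_opp_b_le : (Cmod (- b) + 1 <= R0)%R. Proof. rewrite Cmod_opp; apply Cmod_b_le. Qed.
Lemma Cmod_half_le : (Cmod (1 / 2) + 1 <= R0)%R.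
Proof.
replace (1 / 2) with (RtoC (1 / 2)%R) by (now rewrite RtoC_div by lra).
rewrite Cmod_R, Rabs_pos_eq by lra; pose proof R0_ge_2; lra.
Qed.

(** [1 - 4 p = (1 - 2 x)^2]. *)
Lemma Binom_half (x : C) : (Cmod x < delta)%R -> (1 - 2 * x) * Binom (1 / 2) (4 * P x) = 1.
Proof.
intros Hx.
replace ((1 - 2 * x) * Binom (1 / 2) (4 * P x)) with
  ((1 + - (2) * x) * Binom (1 / 2) (4 * P x)) by ring.
rewrite (disc_const (fun x => (1 + - (2) * x) * Binom (1 / 2) (4 * P x)) delta); trivial.
- unfold P; rewrite Cmult_0_l, !Cmult_0_r, Binom_0; ring.
- intros y Hy.
  assert (H : 1 - 4 * P y <> 0).
  { apply one_minus_neq0; eapply Rlt_le_trans; [apply in_disc_P; trivial; lra|].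
    rewrite <- Rinv_1; apply Rinv_le_contravar; pose proof R0_ge_2; lra. }
  eapply cderive_eq.
  + apply cderive_mult.
    * apply cderive_plus; [apply cderive_const|].
      apply cderive_mult; [apply cderive_const|apply cderive_id].
    * apply (cderive_Binom_comp _ R0 (fun x => 4 * P x)).
      -- apply Cmod_half_le.
      -- apply cderive_mult; [apply cderive_const|apply cderive_parabola].
      -- apply in_disc_P; trivial; lra.
  + cbv beta; unfold P in *; field.
    cbv beta; intros E; apply H; rewrite <- E; ring.
Qed.

Lemma one_minus_neq0_R0 (y : C) : (Cmod y < / R0)%R -> 1 - y <> 0.
Proof.
intros Hy; apply one_minus_neq0; eapply Rlt_le_trans; [exact Hy|].
rewrite <- Rinv_1; apply Rinv_le_contravar; pose proof R0_ge_2; lra.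
Qed.

(** [1 - 3 p = (1 - x)^3 (1 - w)], raised to the power [b = 2 a / 3]. *)
Lemma Binom_quadratic (x : C) : (Cmod x < delta)%R ->
  Binom (- b) (3 * P x) * (Binom a x * Binom a x * Binom b (cubic_arg x)) = 1.
Proof.
intros Hx.
rewrite (disc_const (fun x =>
  Binom (- b) (3 * P x) * (Binom a x * Binom a x * Binom b (cubic_arg x))) delta); trivial.
- unfold P, cubic_arg; rewrite Cmult_0_l, Cmult_0_r.
  replace ((0 / (0 - 1)) ^ 3) with (RtoC 0) by (simpl; unfold Cdiv; ring).
  rewrite !Binom_0; ring.
- intros y Hy; destruct delta_bounds as [Hr [Hr1 Hr2]].
  assert (H1 : 1 - 3 * P y <> 0) by (apply one_minus_neq0_R0, in_disc_P; trivial; lra).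
  assert (H2 : 1 - cubic_arg y <> 0) by (now apply one_minus_neq0_R0, in_disc_cubic).
  assert (H3 : 1 - y <> 0) by (now apply one_minus_neq0_R0, in_disc_id).
  assert (HBa : cderive (Binom a) y (a * 1 / (1 - y) * Binom a y)).
  { apply (cderive_Binom_comp a R0 (fun x => x));
      [apply Cmod_a_le|apply cderive_id|now apply in_disc_id]. }
  eapply cderive_eq.
  + apply cderive_mult; [|apply cderive_mult; [apply cderive_mult; exact HBa|]].
    * apply (cderive_Binom_comp _ R0 (fun x => 3 * P x)).
      -- apply Cmod_opp_b_le.
      -- apply cderive_mult; [apply cderive_const|apply cderive_parabola].
      -- apply in_disc_P; trivial; lra.
    * apply (cderive_Binom_comp _ R0 cubic_arg).
      -- apply Cmod_b_le.
      -- apply cderive_cubic_arg; lra.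
      -- now apply in_disc_cubic.
  + cbv beta.
    assert (E : 1 - cubic_arg y = (1 - 3 * P y) / (1 - y) ^ 3).
    { unfold cubic_arg, P.
      replace (y / (y - 1)) with (- y / (1 - y)).
      - field; trivial.
      - field; split; trivial; intros E; apply H3.
        replace (1 - y) with (- (y - 1)) by ring; rewrite E; ring. }
    rewrite E; unfold b; unfold P in *.
    field; split; trivial.
    cbv beta; intros E'; apply H1; rewrite <- E'; ring.
Qed.

Let appell_coef (n : nat) : C := ratio a n * binom2 (1 / 2) b 4 3 n.
Let gauss_coef (n : nat) : C := ratio (a / 3) n * binom b n.

Lemma admissible_third : admissible (a / 3).
Proof.
intros n Hn E; apply (Ha (3 * n)%nat); [lia|].
rewrite mult_INR, RtoC_mult.
replace (RtoC (INR 3)) with (RtoC 3) by (f_equal; simpl; ring).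
replace (a + 3 * INR n) with (3 * (a / 3 + INR n)) by field.
rewrite E; ring.
Qed.

(** The difference of the two sides, multiplied by [(1 - x)^a]; this factor makes
    the coefficient of the differential equation the constant [a]. *)
Let defect (x : C) : C :=
  Binom (- a) x * CPS appell_coef (P x)
  + - (1) * (Binom a x * CPS gauss_coef (cubic_arg x)).

Lemma Cmod_4_le : (Cmod 4 <= 4)%R. Proof. rewrite Cmod_R, Rabs_pos_eq; lra. Qed.
Lemma Cmod_3_le : (Cmod 3 <= 4)%R. Proof. rewrite Cmod_R, Rabs_pos_eq; lra. Qed.

Lemma converges_in_appell_coef : converges_in (/ (2 * R0 * 4)) appell_coef.
Proof.
apply converges_in_appellF1; auto using Cmod_half_le, Cmod_b_le, Cmod_4_le, Cmod_3_le; lra.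
Qed.

Lemma converges_in_gauss_coef : converges_in (/ R0) gauss_coef.
Proof. apply converges_in_hyp2F1; [apply admissible_third|apply Cmod_b_le]. Qed.

Lemma appell_ode (x : C) : (Cmod x < delta)%R ->
  P x * CPS (cderiv appell_coef) (P x) + a * CPS appell_coef (P x)
  = a * (Binom (1 / 2) (4 * P x) * Binom b (3 * P x)).
Proof.
intros Hx.
rewrite <- (CPS_binom2 (1 / 2) b 4 3 R0 4);
  auto using Cmod_half_le, Cmod_b_le, Cmod_4_le, Cmod_3_le, in_disc_P_appell; [|lra].
apply CPS_linear_ode with (/ (2 * R0 * 4))%R.
- apply converges_in_appell_coef.
- apply converges_in_binom2; auto using Cmod_half_le, Cmod_b_le, Cmod_4_le, Cmod_3_le; lra.
- now apply in_disc_P_appell.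
- intros n; unfold appell_coef; rewrite Cmult_assoc, ratio_spec by trivial; reflexivity.
Qed.

Lemma gauss_ode (x : C) : (Cmod x < delta)%R ->
  3 * cubic_arg x * CPS (cderiv gauss_coef) (cubic_arg x) + a * CPS gauss_coef (cubic_arg x)
  = a * Binom b (cubic_arg x).
Proof.
intros Hx.
assert (E : cubic_arg x * CPS (cderiv gauss_coef) (cubic_arg x) + a / 3 * CPS gauss_coef (cubic_arg x)
  = a / 3 * Binom b (cubic_arg x)).
{ apply CPS_linear_ode with (/ R0)%R.
  - apply converges_in_gauss_coef.
  - apply converges_in_binom, Cmod_b_le.
  - now apply in_disc_cubic.
  - intros n; unfold gauss_coef; rewrite Cmult_assoc, ratio_spec; [reflexivity|apply admissible_third]. }
replace (a * Binom b (cubic_arg x)) with (3 * (a / 3 * Binom b (cubic_arg x))) by field.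
rewrite <- E; field.
Qed.

Lemma smooth_defect (n : nat) : smooth delta n defect.
Proof.
destruct delta_bounds as [Hr [Hr1 Hr2]].
assert (HB : forall c, (Cmod c + 1 <= R0)%R -> smooth delta n (Binom c)).
{ intros c Hc; apply smooth_CPS, converges_in_le with (/ R0)%R; [|now apply converges_in_binom].
  pose proof R0_ge_2; apply Rinv_le_contravar; lra. }
apply smooth_plus.
- apply smooth_mult; [apply HB, Cmod_opp_a_le|].
  apply smooth_comp with (/ (2 * R0 * 4))%R.
  + apply smooth_CPS, converges_in_appell_coef.
  + apply smooth_mult; [apply smooth_id|].
    apply smooth_plus; [apply smooth_const|].
    apply smooth_mult; [apply smooth_const|apply smooth_id].
  + exact in_disc_P_appell.
- apply smooth_mult; [apply smooth_const|].
  apply smooth_mult; [apply HB, Cmod_a_le|].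
  apply smooth_comp with (/ R0)%R.
  + apply smooth_CPS, converges_in_gauss_coef.
  + apply smooth_cubic_arg; lra.
  + exact in_disc_cubic.
Qed.

Lemma cderive_defect (x : C) : (Cmod x < delta)%R ->
  cderive defect x
    (- a / (1 - x) * Binom (- a) x * CPS appell_coef (P x)
     + Binom (- a) x * ((1 - 2 * x) * CPS (cderiv appell_coef) (P x))
     - (a / (1 - x) * Binom a x * CPS gauss_coef (cubic_arg x)
        + Binom a x * (- (3) * x ^ 2 / (1 - x) ^ 4 * CPS (cderiv gauss_coef) (cubic_arg x)))).
Proof.
intros Hx; destruct delta_bounds as [Hr [Hr1 Hr2]].
assert (H1 : 1 - x <> 0) by (now apply one_minus_neq0_R0, in_disc_id).
eapply cderive_eq.
- apply cderive_plus;
    [apply cderive_mult|apply cderive_mult; [apply cderive_const|apply cderive_mult]].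
  + apply (cderive_Binom_comp (- a) R0 (fun x => x));
      [apply Cmod_opp_a_le|apply cderive_id|now apply in_disc_id].
  + apply cderive_comp; [|apply cderive_parabola].
    apply cderive_CPS with (/ (2 * R0 * 4))%R; [apply converges_in_appell_coef|now apply in_disc_P_appell].
  + apply (cderive_Binom_comp a R0 (fun x => x));
      [apply Cmod_a_le|apply cderive_id|now apply in_disc_id].
  + apply cderive_comp; [|apply cderive_cubic_arg; lra].
    apply cderive_CPS with (/ R0)%R; [apply converges_in_gauss_coef|now apply in_disc_cubic].
- cbv beta; fold (P x); field; trivial.
Qed.

(** By [appell_ode] and [gauss_ode], [(1 - x) (x D' + a D)] is [a] times
    [(1 - 2 x) (1 - x)^a (1 - 4 p)^(-1/2) (1 - 3 p)^(-b)
     - (1 - x)^(-a) (1 - w)^(-b)],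
    which vanishes by [Binom_half] and [Binom_quadratic]. *)
Lemma defect_ode (x d : C) : (Cmod x < delta)%R -> cderive defect x d -> x * d + a * defect x = 0.
Proof.
intros Hx Hd; destruct delta_bounds as [Hr [Hr1 Hr2]].
assert (H1 : 1 - x <> 0) by (now apply one_minus_neq0_R0, in_disc_id).
pose proof (appell_ode x Hx) as Eg; pose proof (gauss_ode x Hx) as Ek.
pose proof (Binom_half x Hx) as E1; pose proof (Binom_quadratic x Hx) as E2.
pose proof (Binom_opp a x R0 Cmod_a_le (in_disc_id x Hx)) as E3.
pose proof (Binom_opp b (3 * P x) R0 Cmod_b_le (in_disc_P 3 x ltac:(lra) Hx)) as E4.
rewrite (cderive_unique defect x d _ Hd (cderive_defect x Hx)); unfold defect; clear Hd.
assert (Ew : - (3) * x ^ 2 / (1 - x) ^ 4 * x = 3 * cubic_arg x / (1 - x)).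
{ unfold cubic_arg; replace (x / (x - 1)) with (- x / (1 - x)).
  - field; trivial.
  - field; split; trivial; intros E; apply H1.
    replace (1 - x) with (- (x - 1)) by ring; rewrite E; ring. }
set (A := Binom (- a) x) in *; set (A' := Binom a x) in *.
set (B1 := Binom (1 / 2) (4 * P x)) in *; set (B2 := Binom b (3 * P x)) in *.
set (B2' := Binom (- b) (3 * P x)) in *.
set (B3 := Binom b (cubic_arg x)) in *.
set (G := CPS appell_coef (P x)) in *; set (K := CPS gauss_coef (cubic_arg x)) in *.
set (G' := CPS (cderiv appell_coef) (P x)) in *; set (K' := CPS (cderiv gauss_coef) (cubic_arg x)) in *.
set (W := cubic_arg x) in *.
set (dW := - (3) * x ^ 2 / (1 - x) ^ 4) in *.
(* The equation (1 - x)^a (1 - 3 p)^(-b) = (1 - x)^(-a) (1 - w)^(-b). *)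
assert (E5 : A * B2 = A' * B3).
{ replace (A * B2) with (A * B2 * 1) by ring; rewrite <- E2.
  replace (A * B2 * (B2' * (A' * A' * B3))) with ((A' * A) * (B2 * B2') * (A' * B3)) by ring.
  rewrite E3, E4; ring. }
match goal with |- ?l = _ => assert (E6 : (1 - x) * l = 0) end.
{ transitivity (A * (1 - 2 * x) * (P x * G' + a * G)
     - A' * ((1 - x) * (dW * x) * K' + a * K)).
  - unfold P; field; trivial.
  - rewrite Ew.
    replace ((1 - x) * (3 * W / (1 - x))) with (3 * W) by (field; trivial).
    rewrite Eg, Ek.
    replace (A * (1 - 2 * x) * (a * (B1 * B2)) - A' * (a * B3)) with
      (a * (((1 - 2 * x) * B1) * (A * B2) - A' * B3)) by ring.
    rewrite E1, E5; ring. }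
match goal with |- ?l = _ => replace l with (/ (1 - x) * ((1 - x) * l)) end.
- rewrite E6; ring.
- rewrite Cmult_assoc, Cinv_l by trivial; apply Cmult_1_l.
Qed.

Lemma defect_eq_0 (x : C) : (Cmod x < delta)%R -> defect x = 0.
Proof.
destruct (INR_unbounded (- Re a)) as [n Hn].
apply (euler_ode_zero delta n a defect).
- lra.
- exact Ha.
- apply smooth_defect.
- exact defect_ode.
- unfold defect, P, cubic_arg; rewrite Cmult_0_l.
  replace ((0 / (0 - 1)) ^ 3) with (RtoC 0) by (simpl; unfold Cdiv; ring).
  rewrite !Binom_0.
  pose proof R0_ge_2.
  rewrite (CPS_0 (/ (2 * R0 * 4))), (CPS_0 (/ R0)).
  + unfold appell_coef, gauss_coef, ratio, binom2, diagonal, binom; rewrite Csum_0; simpl; field.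
  + apply Rinv_0_lt_compat; lra.
  + apply converges_in_gauss_coef.
  + apply Rinv_0_lt_compat; lra.
  + apply converges_in_appell_coef.
Qed.

Lemma appellF1_cubic_transformation (x : C) : (Cmod x < delta)%R ->
  exists f F : C,
    is_hyp2F1 (a / 3) (2 * a / 3) (a / 3 + 1) ((x / (x - 1)) ^ 3) f /\
    is_appellF1 a (1 / 2) (2 / 3 * a) (a + 1) (4 * x * (1 - x)) (3 * x * (1 - x)) F /\
    Cpower (1 - x) (- (2 * a)) * f = F.
Proof.
intros Hx.
assert (Eb : 2 * a / 3 = b) by (unfold b; field).
exists (CPS gauss_coef (cubic_arg x)), (CPS appell_coef (P x)).
split; [|split].
- rewrite Eb; apply is_hyp2F1_succ with R0;
    [apply admissible_third|apply Cmod_b_le|now apply in_disc_cubic].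
- replace (4 * x * (1 - x)) with (4 * P x) by (unfold P; ring).
  replace (3 * x * (1 - x)) with (3 * P x) by (unfold P; ring).
  apply is_appellF1_ray with R0 4%R;
    auto using Cmod_half_le, Cmod_b_le, Cmod_4_le, Cmod_3_le, in_disc_P_appell; lra.
- pose proof (defect_eq_0 x Hx) as E; unfold defect in E.
  pose proof (Binom_opp a x R0 Cmod_a_le (in_disc_id x Hx)) as E3.
  rewrite (Cpower_Binom a x R0 Cmod_a_le (in_disc_id x Hx)).
  set (A := Binom (- a) x) in *; set (A' := Binom a x) in *.
  set (G := CPS appell_coef (P x)) in *; set (K := CPS gauss_coef (cubic_arg x)) in *.
  transitivity (A' * (A * G) - A' * (A * G + - (1) * (A' * K))); [ring|].
  rewrite E; transitivity ((A' * A) * G); [ring|rewrite E3; ring].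
Qed.
End Identity.

Theorem mainTheorem3 :
  forall a : C,
    (forall n : nat, (1 <= n)%nat -> a <> - INR n) ->
    exists delta : R, (0 < delta)%R /\
      forall x : C, (Cmod x < delta)%R ->
        exists f F : C,
          is_hyp2F1 (a / 3) (2 * a / 3) (a / 3 + 1) ((x / (x - 1)) ^ 3) f /\
          is_appellF1 a (1 / 2) (2 / 3 * a) (a + 1)
            (4 * x * (1 - x)) (3 * x * (1 - x)) F /\
          Cpower (1 - x) (- (2 * a)) * f = F.
Proof.
intros a H.
assert (Ha : admissible a).
{ intros n Hn E; apply (H n Hn).
  replace a with ((a + INR n) - INR n) by ring; rewrite E; ring. }
exists (/ (32 * (Cmod a + 2)))%R; split; [exact (proj1 (delta_bounds a))|].
exact (appellF1_cubic_transformation a Ha).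
Qed.
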